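(* For each of the following pairs $(\alpha,\beta)$ there exists a binary self-dual $[92,46,16]$ code whose weight enumerator is of the form $$W_{92,1}=1+(4692+4\alpha)x^{16}+(174800-8\alpha+256\beta)x^{18}+(2425488-52\alpha-2048\beta)x^{20}+\cdots:$$ - $\beta=-69$ and $\alpha=23\cdot 78$; - $\beta=-46$ and $\alpha\in\{23z:z=61,69,79,82,85\}$; - $\beta=-23$ and $\alpha\in\{23z:z=48,57,67,76\}$; - $\beta=0$ and $\alpha\in\{23z:z=31,57\}$.
   Context: A binary $[n,k,d]$ code is a $k$-dimensional linear subspace of $\mathbb{F}_2^n$ with minimum Hamming distance $d$. It is self-dual if it equals its dual with respect to the Euclidean inner product $\langle\mathbf{x},\mathbf{y}\rangle=\sum_i x_iy_i$. The weight enumerator is $\sum_i A_i x^i$, where $A_i$ is the number of codewords of Hamming weight $i$; in the displayed form, $\cdots$ stands for terms of higher degree, so the form specifies the coefficients of all powers of $x$ up to $x^{20}$. *)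

(* Defs.v *)
From HB Require Import structures.
From mathcomp Require Import all_boot all_order all_algebra.

Set Implicit Arguments.
Unset Strict Implicit.
Unset Printing Implicit Defensive.

Import GRing.Theory.
Local Open Scope ring_scope.

Notation binary_code n := {vspace 'rV['F_2]_n}.

Definition hamming_distance (n : nat) (x y : 'rV['F_2]_n) : nat :=
  #|[set i | x 0 i != y 0 i]|.

Definition hamming_weight (n : nat) (x : 'rV['F_2]_n) : nat :=
  #|[set i | x 0 i != 0]|.

Definition has_min_distance (n : nat) (C : binary_code n) (d : nat) : Prop :=
  (forall x y, x \in C -> y \in C -> x != y -> (d <= hamming_distance x y)%N)
  /\ (exists x y, [/\ x \in C, y \in C, x != y & hamming_distance x y = d]).

Definition is_linear_code (n k d : nat) (C : binary_code n) : Prop :=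
  \dim C = k /\ has_min_distance C d.

Definition inner_product (n : nat) (x y : 'rV['F_2]_n) : 'F_2 :=
  \sum_(i < n) x 0 i * y 0 i.

Definition dual_code (n : nat) (C : binary_code n) : {set 'rV['F_2]_n} :=
  [set x | [forall y in C, inner_product x y == 0]].

Definition self_dual (n : nat) (C : binary_code n) : Prop :=
  C =i dual_code C.

Definition weight_count (n : nat) (C : binary_code n) (i : nat) : nat :=
  #|[set x in C | hamming_weight x == i]|.

(* Integer rather than natural coefficients, since the parameters of the
   prescribed weight enumerators may be negative. *)
Definition weight_enumerator (n : nat) (C : binary_code n) : {poly int} :=
  \sum_(i < n.+1) (weight_count C i)%:Z *: 'X^i.

(* The part of W_{92,1} of degree at most 20. The two large constants go through
   nat_scope, whose numerals above 5000 are kept abstract ([Nat.of_num_uint]);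
   as plain ring numerals they would be expanded in unary. *)
Definition W92_1 (alpha beta : int) : {poly int} :=
  1 + (4692 + 4 * alpha) *: 'X^16
    + (174800%N%:R - 8 * alpha + 256 * beta) *: 'X^18
    + (2425488%N%:R - 52 * alpha - 2048 * beta) *: 'X^20.

(* Main.v *)
Require Import Defs.
From HB Require Import structures.
From Stdlib Require Import NArith ZArith.
From mathcomp Require Import all_boot all_order all_algebra.
From mathcomp Require Import ssrZ zify ring.

Set Implicit Arguments.
Unset Strict Implicit.
Unset Printing Implicit Defensive.

Import GRing.Theory.

Delimit Scope Z_scope with coqZ.

(** The codes are the row spaces of [I | M], where M is an orthogonal 46 x 46 matrix made
    of four circulant blocks of order 23, so that the cyclic group of order 23 acts on the
    code. They were found by a computer search over GL_2 of the field with 2^11 elements,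
    which parametrises such M.

    By the MacWilliams identities for the code C and for its shadow S (a coset of C), the
    numbers A_16, A_18, A_20 of codewords are affine functions of the numbers of shadow
    vectors of weights 10 and 14 once C has minimum weight 16 and S has no vector of even
    weight at most 12 other than 10. In terms of alpha and beta there are -beta and
    alpha + 18 beta such shadow vectors. Hence only words of weight at most 14 of C and S
    need to be listed. Such a word has weight at most 7 on the left or at most 6 on the
    right half, and both halves are information sets. Since 23 is prime, a nonempty proper
    set of positions of one block has exactly one cyclic translate whose sum of positions
    is 0 modulo 23, which divides the work by 23. Finally, to find the pairs of partial
    sums at distance at most t, 46 coordinates are cut into four quarters: in one of them
    the distance is at most about t/4, and that quarter is searched in a trie. *)

(** * Searching for words of small weight *)

Inductive oct := O0 | O1 | O2 | O3 | O4 | O5 | O6 | O7.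
Definition nat_of_oct (a : oct) : nat :=
  match a with O0 => 0 | O1 => 1 | O2 => 2 | O3 => 3 | O4 => 4 | O5 => 5 | O6 => 6 | O7 => 7 end.
Lemma nat_of_octK : cancel nat_of_oct (nth O0 [:: O0; O1; O2; O3; O4; O5; O6; O7]).
Proof. by case. Qed.
HB.instance Definition _ := Equality.copy oct (can_type nat_of_octK).

(* Words of length 46, padded to 48; the first coordinate of a digit is its highest bit. *)
Definition word := seq oct.

Definition oxor (a b : oct) : oct :=
  match a with
  | O0 => b
  | O1 => match b with O0 => O1 | O1 => O0 | O2 => O3 | O3 => O2 | O4 => O5 | O5 => O4 | O6 => O7 | O7 => O6 end
  | O2 => match b with O0 => O2 | O1 => O3 | O2 => O0 | O3 => O1 | O4 => O6 | O5 => O7 | O6 => O4 | O7 => O5 end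
  | O3 => match b with O0 => O3 | O1 => O2 | O2 => O1 | O3 => O0 | O4 => O7 | O5 => O6 | O6 => O5 | O7 => O4 end
  | O4 => match b with O0 => O4 | O1 => O5 | O2 => O6 | O3 => O7 | O4 => O0 | O5 => O1 | O6 => O2 | O7 => O3 end
  | O5 => match b with O0 => O5 | O1 => O4 | O2 => O7 | O3 => O6 | O4 => O1 | O5 => O0 | O6 => O3 | O7 => O2 end
  | O6 => match b with O0 => O6 | O1 => O7 | O2 => O4 | O3 => O5 | O4 => O2 | O5 => O3 | O6 => O0 | O7 => O1 end
  | O7 => match b with O0 => O7 | O1 => O6 | O2 => O5 | O3 => O4 | O4 => O3 | O5 => O2 | O6 => O1 | O7 => O0 end
  end.

Definition owt (a : oct) : nat :=
  match a with O0 => 0 | O1 | O2 | O4 => 1 | O3 | O5 | O6 => 2 | O7 => 3 end.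

Fixpoint wxor (x y : word) : word :=
  match x, y with a :: x', b :: y' => oxor a b :: wxor x' y' | _, _ => [::] end.
Definition wwt (x : word) : nat := foldr (fun a n => owt a + n) 0 x.

(** The budget [h] is spent digit by digit, so that most pairs are rejected before their distance is
    computed in full. *)
Fixpoint within (h : nat) (x y : word) {struct x} : bool :=
  match x, y with
  | a :: x', b :: y' =>
    match owt (oxor a b) with
    | 0 => within h x' y'
    | 1 => match h with h'.+1 => within h' x' y' | _ => false end
    | 2 => match h with h'.+2 => within h' x' y' | _ => false end
    | _ => match h with h'.+3 => within h' x' y' | _ => false end
    end
  | _, _ => true
  end.

Inductive trie :=
  Leaf of seq word | Branch of trie & trie & trie & trie & trie & trie & trie & trie.

Fixpoint insert (k y : word) (t : trie) : trie :=
  match k with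
  | [::] => match t with Leaf L => Leaf (y :: L) | _ => t end
  | a :: k' =>
    match t with
    | Branch c0 c1 c2 c3 c4 c5 c6 c7 =>
      match a with
      | O0 => Branch (insert k' y c0) c1 c2 c3 c4 c5 c6 c7
      | O1 => Branch c0 (insert k' y c1) c2 c3 c4 c5 c6 c7
      | O2 => Branch c0 c1 (insert k' y c2) c3 c4 c5 c6 c7
      | O3 => Branch c0 c1 c2 (insert k' y c3) c4 c5 c6 c7
      | O4 => Branch c0 c1 c2 c3 (insert k' y c4) c5 c6 c7
      | O5 => Branch c0 c1 c2 c3 c4 (insert k' y c5) c6 c7
      | O6 => Branch c0 c1 c2 c3 c4 c5 (insert k' y c6) c7
      | O7 => Branch c0 c1 c2 c3 c4 c5 c6 (insert k' y c7)
      end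
    | Leaf _ =>
      let e := Leaf [::] in
      match a with
      | O0 => Branch (insert k' y e) e e e e e e e
      | O1 => Branch e (insert k' y e) e e e e e e
      | O2 => Branch e e (insert k' y e) e e e e e
      | O3 => Branch e e e (insert k' y e) e e e e
      | O4 => Branch e e e e (insert k' y e) e e e
      | O5 => Branch e e e e e (insert k' y e) e e
      | O6 => Branch e e e e e e (insert k' y e) e
      | O7 => Branch e e e e e e e (insert k' y e)
      end
    end
  end.

(* The eight branches are passed in order of their distance 0, 1, 1, 1, 2, 2, 2, 3
   from the digit looked up. *)
Definition visit (R : nat -> trie -> seq nat -> seq nat) (h : nat) (acc : seq nat)
    (c0 c1 c2 c4 c3 c5 c6 c7 : trie) :=
  R h c0 match h with 0 => acc | h1.+1 => R h1 c1 (R h1 c2 (R h1 c4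
    match h1 with 0 => acc | h2.+1 => R h2 c3 (R h2 c5 (R h2 c6
      match h2 with 0 => acc | h3.+1 => R h3 c7 acc end)) end)) end.

Fixpoint near (keep : word -> seq nat -> seq nat) (x : word) (h : nat) (t : trie)
    (acc : seq nat) {struct x} : seq nat :=
  match t with
  | Leaf L => foldr keep acc L
  | Branch c0 c1 c2 c3 c4 c5 c6 c7 =>
    match x with
    | [::] => acc
    | a :: x' =>
      match a with
      | O0 => visit (near keep x') h acc c0 c1 c2 c4 c3 c5 c6 c7
      | O1 => visit (near keep x') h acc c1 c0 c3 c5 c2 c4 c7 c6
      | O2 => visit (near keep x') h acc c2 c3 c0 c6 c1 c7 c4 c5
      | O3 => visit (near keep x') h acc c3 c2 c1 c7 c0 c6 c5 c4
      | O4 => visit (near keep x') h acc c4 c5 c6 c0 c7 c1 c2 c3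
      | O5 => visit (near keep x') h acc c5 c4 c7 c1 c6 c0 c3 c2
      | O6 => visit (near keep x') h acc c6 c7 c4 c2 c5 c3 c0 c1
      | O7 => visit (near keep x') h acc c7 c6 c5 c3 c4 c2 c1 c0
      end
    end
  end.

(* [z] is cut into quarters; the test says that quarter [j] is the first whose
   weight is at most its radius. *)
Fixpoint first_part (hs : seq nat) (j : nat) (z : word) : bool :=
  match hs, j with
  | h :: hs', 0 => wwt (take 4 z) <= h
  | h :: hs', j'.+1 => (h < wwt (take 4 z)) && first_part hs' j' (drop 4 z)
  | _, _ => false
  end.

Definition keep (t : nat) (hs : seq nat) (j : nat) (x y : word) (acc : seq nat) :=
  if within t x y then
    let z := wxor x y in
    if first_part hs j z && (wwt z <= t) then wwt z :: acc else acc
  else acc.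

(** By the identity for sums of floors the radii add up to at least [t] - 3. A word exceeding its
    radius in all four quarters would therefore have weight at least [t] + 1. *)
Definition radii (t : nat) := [:: t %/ 4; (t - 1) %/ 4; (t - 2) %/ 4; (t - 3) %/ 4].

(** The first component of a pair is the part of the key not yet consumed, the second the whole
    word: trie number j is indexed by quarter j but stores full words. *)
Fixpoint tries (n : nat) (Y : seq (word * word)) : seq trie :=
  match n with
  | 0 => [::]
  | n'.+1 => foldr (fun y => insert (take 4 y.1) y.2) (Leaf [::]) Y
             :: tries n' [seq (drop 4 y.1, y.2) | y <- Y]
  end.

Fixpoint hits_from (t : nat) (hs hs0 : seq nat) (j : nat) (x : word) (T : seq trie)
    (xr : word) (acc : seq nat) : seq nat :=
  match T, hs with
  | tr :: T', h :: hs' =>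
    near (keep t hs0 j x) xr h tr (hits_from t hs' hs0 j.+1 x T' (drop 4 xr) acc)
  | _, _ => acc
  end.

Definition wzero : word := nseq 16 O0.
Definition wones : word := rcons (nseq 15 O7) O4.

Definition hits (t : nat) (hs : seq nat) (T : seq trie) (x : word) := hits_from t hs hs 0 x T x.

(* In all pairs of lists below the first list is for the code, the second for its shadow. *)
Definition join1 (tc ts : nat) (X Y : seq word) (acc : seq nat * seq nat) :=
  let T := tries 4 [seq (y, y) | y <- Y] in
  let hc := radii tc in
  let hs := radii ts in
  (foldr (hits tc hc T) acc.1 X, foldr (fun x => hits ts hs T (wxor wones x)) acc.2 X).
(** The longer list is stored in the tries, and the shorter one supplies the queries. *)
Definition join tc ts X Y :=
  if size X <= size Y then join1 tc ts X Y else join1 tc ts Y X.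

(** * Sums of rows, all of them or one per translation class *)

Fixpoint sums_from (k : nat) (L : seq word) (a : word) (acc : seq word) : seq word :=
  match k with
  | 0 => a :: acc
  | k'.+1 => match L with
    | [::] => acc
    | x :: L' => sums_from k' L' (wxor a x) (sums_from k L' a acc)
    end
  end.
Definition sums (k : nat) (L : seq word) := sums_from k L wzero [::].

Inductive stree := SNone | SNil | SCons of stree & stree.
(** Dead branches are pruned here, so that computing sums along the tree never enters a branch
    without admissible subsets. *)
Definition scons t1 t2 := match t1, t2 with SNone, SNone => SNone | _, _ => SCons t1 t2 end.
(* The k-subsets s of 0, ..., n - 1 such that the entry of [st] at the sum of s is true. *)
Fixpoint subset_tree (k : nat) (st : seq bool) (n : nat) : stree :=
  match k, n with
  | 0, _ => if head false st then SNil else SNone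
  | _, 0 => SNone
  | k'.+1, n'.+1 => scons (subset_tree k' (drop k' st) n') (subset_tree k (drop k st) n')
  end.
Fixpoint tree_sums_from (t : stree) (L : seq word) (a : word) (acc : seq word) : seq word :=
  match t with
  | SNone => acc
  | SNil => a :: acc
  | SCons t1 t2 => match L with
    | [::] => acc
    | x :: L' => tree_sums_from t1 L' (wxor a x) (tree_sums_from t2 L' a acc)
    end
  end.

(** At most five indices below 23 have sum at most 110, so for the trees that are kept the table of
    length 162 covers every sum. *)
Definition canonical_tree (k : nat) := subset_tree k (mkseq (fun i => 23 %| i) 162) 23.
Definition canonical_trees := [seq canonical_tree k | k <- iota 0 6].
Definition canonical_sums (k : nat) (L : seq word) :=
  tree_sums_from (nth SNone canonical_trees k) L wzero [::].

Definition rotate (a : seq bool) (i : nat) : seq bool :=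
  mkseq (fun j => nth false a ((j + (23 - i)) %% 23)) 23.
(** This is the first row of the transposed circulant. *)
Definition flip (a : seq bool) : seq bool := mkseq (fun j => nth false a ((23 - j) %% 23)) 23.
Fixpoint pack (n : nat) (s : seq bool) : word :=
  match n, s with
  | n'.+1, a :: b :: c :: s' =>
    (if a then if b then if c then O7 else O6 else if c then O5 else O4
     else if b then if c then O3 else O2 else if c then O1 else O0) :: pack n' s'
  | _, _ => [::]
  end.
Definition gens (a b : seq bool) : seq word :=
  mkseq (fun i => pack 16 (rotate a i ++ rotate b i ++ [:: false; false])) 23.

(* The sums of a rows of G1 and b rows of G2, up to simultaneous cyclic translation. Only
   tables for at most 5 rows are kept: for b = 6, 7 the representatives are chosen on the
   a <= 1 rows of G1, and the rows of G2 are split to keep the lists short. *)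
Definition type_hits_le (tc ts : nat) (G1 G2 : seq word) (a b : nat) : seq nat * seq nat :=
  if 5 < b then
    foldr (fun i => join tc ts
        (foldr (fun x0 => sums_from i (take 11 G2) x0) [::] (canonical_sums a G1))
        (sums (b - i) (drop 11 G2)))
      ([::], [::]) (iota 0 b.+1)
  else join tc ts (sums a G1) (canonical_sums b G2) ([::], [::]).
Definition type_hits (tc ts : nat) (G1 G2 : seq word) (a b : nat) :=
  if a <= b then type_hits_le tc ts G1 G2 a b else type_hits_le tc ts G2 G1 b a.
(** When one number is 0 and the other exceeds 5, representatives would be chosen on the empty set,
    which every translation fixes: nothing is saved and each word is listed once. Otherwise each
    listed word stands for its 23 translates. *)
Definition multiplicity (a b : nat) := if (minn a b == 0) && (5 < maxn a b) then 1 else 23.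

(* (number l of information ones, bound on the other weight in the code, same in the shadow) *)
Definition left_bounds :=
  [:: (1, 13, 13); (2, 10, 12); (3, 11, 11); (4, 8, 10); (5, 9, 9); (6, 6, 8); (7, 7, 7)].
(** The two halves of a codeword have weights congruent modulo 4 ([quad_doubly_even]), so the code
    bounds in both tables are the largest r at most 14 - l with r congruent to l. In the last row
    only left weight 8 would remain to be treated, and 8 is not congruent to 6; hence the bound
    0. *)
Definition right_bounds :=
  [:: (1, 13, 13); (2, 10, 12); (3, 11, 11); (4, 8, 10); (5, 9, 9); (6, 0, 8)].

Definition run (B : seq (nat * nat * nat)) (G1 G2 : seq word) :=
  [seq (b.1.1, [seq (multiplicity a (b.1.1 - a), type_hits b.1.2 b.2 G1 G2 a (b.1.1 - a))
               | a <- iota 0 b.1.1.+1]) | b <- B].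
Definition no_code_word (R : seq (nat * seq (nat * (seq nat * seq nat)))) :=
  all (fun row => all (fun x => nilp x.2.1) row.2) R.
(** The threshold [m] on the other half prevents double counting: it is 0 for the left table and 8
    for the right one, whose words of left weight at most 7 are already in the left table. *)
Definition shadow_count (R : seq (nat * seq (nat * (seq nat * seq nat)))) (w m : nat) :=
  foldr (fun row n =>
    if m <= w - row.1 then
      foldr (fun x n => x.1 * count (eqn (w - row.1)) x.2.2 + n) n row.2
    else n) 0 R.

(* The rows of M are orthonormal, and their weights modulo 4 make the weight of a word (v, v M)
   even and congruent to twice the weight of v M modulo 4: the shadow is the coset of (0, 1). *)
Definition unitary_gens (G : seq word) :=
  all (fun x => eqn (wwt x %% 4) 1) G && pairwise (fun x y => eqn (wwt (wxor x y) %% 4) 2) G.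

(** The second run uses the transpose of M, which is its inverse, and so lists the same words by
    their right halves. *)
Definition check_code (abcd : seq bool * seq bool * (seq bool * seq bool)) (s10 s14 : nat) : bool :=
  let: (a, b, (c, d)) := abcd in
  let G1 := gens a b in
  let G2 := gens c d in
  unitary_gens (G1 ++ G2) &&
  let L := run left_bounds G1 G2 in
  let R := run right_bounds (gens (flip a) (flip c)) (gens (flip b) (flip d)) in
  [&& no_code_word L, no_code_word R &
    all (fun w => eqn (shadow_count L w 0 + shadow_count R w 8)
        (if eqn w 10 then s10 else if eqn w 14 then s14 else 0))
      [:: 0; 2; 4; 6; 8; 10; 12; 14]].

Fixpoint bits (n : nat) (x : N) : seq bool :=
  match n with 0 => [::] | n'.+1 => N.odd x :: bits n' (N.div2 x) end.
Definition code_data (a b c d : N) := ((bits 23 a, bits 23 b), (bits 23 c, bits 23 d)).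

(** * Elementary properties of packed words *)

Lemma oxorC : commutative oxor. Proof. by case; case. Qed.
Lemma oxorA : associative oxor. Proof. by case; case; case. Qed.
Lemma wxorC : commutative wxor.
Proof. by elim=> [|a x IH] [|b y] //=; rewrite oxorC IH. Qed.
Lemma wxorA : associative wxor.
Proof. by elim=> [|a x IH] [|b y] [|c z] //=; rewrite oxorA IH. Qed.
Lemma size_wxor x y : size (wxor x y) = minn (size x) (size y).
Proof. by elim: x y => [|a x IH] [|b y] //=; rewrite ?minn0 ?min0n // IH minnSS. Qed.
Lemma drop_wxor n x y : drop n (wxor x y) = wxor (drop n x) (drop n y).
Proof. by elim: n x y => [|n IH] [|a x] [|b y] //=; case: (drop n x). Qed.
Lemma wwt_cat x y : wwt (x ++ y) = wwt x + wwt y.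
Proof. by elim: x => //= a x ->; rewrite addnA. Qed.

Lemma withinE h x y : within h x y = (wwt (wxor x y) <= h).
Proof.
elim: x y h => [|a x IH] [|b y] h //=.
by case: (oxor a b) => /=; rewrite ?IH //; case: h => [|[|[|h]]] //=; rewrite ?IH //; lia.
Qed.

(** * Correctness of trie lookups *)

Section Near.
Variables (a : pred nat) (kp : word -> seq nat -> seq nat) (Q : pred word).
Hypothesis kpE : forall y acc, count a (kp y acc) = Q y + count a acc.

(** [visit] threads the accumulator through nested calls; additivity of the count allows the
    branches to be treated independently. *)
Lemma near_acc x h t acc : count a (near kp x h t acc) = count a (near kp x h t [::]) + count a acc.
Proof.
have leafE L c : count a (foldr kp c L) = count Q L + count a c.
  by elim: L => //= y L IH; rewrite kpE IH addnA.
elim: x h t acc => [|o x IH] h [L|c0 c1 c2 c3 c4 c5 c6 c7] acc //=; rewrite ?leafE ?addn0 //.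
by case: o; case: h => [|[|[|h]]]; rewrite /visit; repeat rewrite (IH _ _ (near _ _ _ _ _));
  repeat (rewrite (IH _ _ acc)); lia.
Qed.

Let N x h t := count a (near kp x h t [::]).
Definition sub_near x h o p t := if owt (oxor o p) <= h then N x (h - owt (oxor o p)) t else 0.

(** For every digit [o] the eight branches are permuted by exclusive or with [o]; this puts them
    back in their natural order, each with its own remaining budget. *)
Lemma near_branch o x h c0 c1 c2 c3 c4 c5 c6 c7 :
  N (o :: x) h (Branch c0 c1 c2 c3 c4 c5 c6 c7) =
  sub_near x h o O0 c0 + sub_near x h o O1 c1 + sub_near x h o O2 c2 + sub_near x h o O3 c3 +
  sub_near x h o O4 c4 + sub_near x h o O5 c5 + sub_near x h o O6 c6 + sub_near x h o O7 c7.
Proof.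
rewrite /N /sub_near -/N.
by case: o; case: h => [|[|[|h]]]; rewrite /= /visit; repeat rewrite (near_acc _ _ _ (near _ _ _ _ _));
  rewrite ?subSS ?subn0 /= /N; lia.
Qed.

(** Nonempty leaves lie at depth exactly [d]. Empty leaves may occur higher up, since [insert] grows
    only the branch it needs. *)
Fixpoint wf_trie (d : nat) (t : trie) : bool :=
  match t, d with
  | Leaf L, _ => (d == 0) || nilp L
  | Branch c0 c1 c2 c3 c4 c5 c6 c7, d'.+1 =>
    [&& wf_trie d' c0, wf_trie d' c1, wf_trie d' c2, wf_trie d' c3, wf_trie d' c4, wf_trie d' c5,
        wf_trie d' c6 & wf_trie d' c7]
  | _, _ => false
  end.

Lemma wf_insert k y t : wf_trie (size k) t -> wf_trie (size k) (insert k y t).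
Proof.
elim: k t => [|o k IH] [L|c0 c1 c2 c3 c4 c5 c6 c7] //=.
  move=> _; have e : wf_trie (size k) (Leaf [::]) by case: (size k).
  by case: o; rewrite /= IH ?e.
by move=> /and5P [h0 h1 h2 h3 /and4P[h4 h5 h6 h7]]; case: o => /=; rewrite ?IH ?h0 ?h1 ?h2 ?h3 ?h4 ?h5 ?h6 ?h7.
Qed.

Lemma near_insert k y x h t : wf_trie (size k) t -> size k <= size x ->
  N x h (insert k y t) = ((wwt (wxor x k) <= h) && Q y) + N x h t.
Proof.
elim: k x h t => [|o k IH] x h t.
  case: t => [L|] //= _ _; have -> : wxor x [::] = [::] by case: x.
  by rewrite /N; case: x => [|p x] /=; rewrite kpE.
case: x => [|p x] //; rewrite ltnS => wf kx.
(* An empty leaf above the bottom behaves like a branch with eight empty leaves, both for [near] and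
   for [insert], so only branches need to be considered. *)
wlog: t wf / exists c, t = let: (c0, c1, c2, c3, (c4, c5, c6, c7)) := c in Branch c0 c1 c2 c3 c4 c5 c6 c7.
  move=> W; case: t wf => [L|c0 c1 c2 c3 c4 c5 c6 c7] wf; last first.
    by apply: W => //; exists (c0, c1, c2, c3, (c4, c5, c6, c7)).
  have e : wf_trie (size k) (Leaf [::]) by case: (size k).
  pose e0 := Leaf [::]; have := W (Branch e0 e0 e0 e0 e0 e0 e0 e0).
  have -> : N (p :: x) h (Branch e0 e0 e0 e0 e0 e0 e0 e0) = 0.
    rewrite near_branch /sub_near.
    have e0E h' : N x h' e0 = 0 by rewrite /N; case: (x).
    by rewrite !e0E !if_same.
  have -> : N (p :: x) h (Leaf L) = 0 by move: wf; rewrite /N /=; case: L.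
  have -> : insert (o :: k) y (Leaf L) = insert (o :: k) y (Branch e0 e0 e0 e0 e0 e0 e0 e0) by case: (o).
  by apply; [rewrite /= e | exists (e0, e0, e0, e0, (e0, e0, e0, e0))].
case=> -[[[[c0 c1] c2] c3] [[[c4 c5] c6] c7]] tE; subst t.
move: wf => /= /and5P [h0 h1 h2 h3 /and4P[h4 h5 h6 h7]].
have subE q c : wf_trie (size k) c -> sub_near x h p q (insert k y c) =
    ((owt (oxor p q) + wwt (wxor x k) <= h) && Q y) + sub_near x h p q c.
  move=> wc; rewrite /sub_near; case: ifP => le; first by rewrite IH // leq_subRL.
  by rewrite addn0; case: leqP => // H; move: le; rewrite (leq_trans (leq_addr _ _) H).
by case: o; rewrite /= !near_branch subE //;
  move: (nat_of_bool _) (sub_near _ _ _ O0 _) (sub_near _ _ _ O1 _) (sub_near _ _ _ O2 _)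
    (sub_near _ _ _ O3 _) (sub_near _ _ _ O4 _) (sub_near _ _ _ O5 _) (sub_near _ _ _ O6 _)
    (sub_near _ _ _ O7 _) => *; lia.
Qed.

Lemma near_tries (Y : seq (word * word)) n x h : size x >= 4 -> all (fun y => size y.1 >= 4) Y ->
  N x h (nth (Leaf [::]) (tries n.+1 Y) 0) =
  count (fun y => (wwt (wxor x (take 4 y.1)) <= h) && Q y.2) Y.
Proof.
move=> sx sY /=.
suff : wf_trie 4 (foldr (fun y => insert (take 4 y.1) y.2) (Leaf [::]) Y) /\
   N x h (foldr (fun y => insert (take 4 y.1) y.2) (Leaf [::]) Y) =
  count (fun y => (wwt (wxor x (take 4 y.1)) <= h) && Q y.2) Y by case.
elim: Y sY => [_|[k y] Y IH /= /andP[sk /IH [wf NE]]]; first by split=> //; rewrite /N; case: (x).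
have sz : size (take 4 k) = 4 by rewrite size_takel.
split; first by have := @wf_insert (take 4 k) y; rewrite sz; apply.
by rewrite near_insert ?sz // NE.
Qed.
End Near.

Lemma first_part_le hs j z : first_part hs j z -> wwt (take 4 (drop (4 * j) z)) <= nth 0 hs j.
Proof.
elim: hs j z => [|h hs IH] [|j] z //=; first by rewrite drop0.
by move=> /andP[_ /IH]; rewrite drop_drop mulnS addnC.
Qed.

(** * Each close pair is found exactly once *)

Section Hits.
Variables (a : pred nat) (t : nat) (hs0 : seq nat) (x : word).
Let Q j y := [&& first_part hs0 j (wxor x y), wwt (wxor x y) <= t & a (wwt (wxor x y))].

Lemma keepE j y acc : count a (keep t hs0 j x y acc) = Q j y + count a acc.
Proof.
rewrite /keep withinE /Q; case: (wwt _ <= t); rewrite ?andbF //= andbT.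
by case: (first_part _ _ _).
Qed.

(** Invariant after [j] quarters: [xr] and the keys in [Y] are what remains of the query and of the
    stored words, so their sum is the tail of the full sum. *)
Lemma hits_from_count n j xr (Y : seq (word * word)) acc :
  size xr = 4 * n -> n + j = size hs0 ->
  (forall y, y \in Y -> size y.1 = 4 * n /\ wxor xr y.1 = drop (4 * j) (wxor x y.2)) ->
  count a (hits_from t (drop j hs0) hs0 j x (tries n Y) xr acc) =
  \sum_(i <- iota j n) count (fun y => Q i y.2) Y + count a acc.
Proof.
elim: n j xr Y acc => [|n IH] j xr Y acc sxr nj HY; first by rewrite big_nil; case: (drop j hs0).
have -> : drop j hs0 = nth 0 hs0 j :: drop j.+1 hs0 by apply: drop_nth; rewrite -nj addSn ltnS leq_addl.
rewrite big_cons [tries _ _]/= -[X in hits_from _ _ _ _ _ (X :: _)]/(nth (Leaf [::]) (tries n.+1 Y) 0).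
rewrite [hits_from _ _ _ _ _ _ _ _]/= (near_acc (@keepE j)) IH; last 1 first.
- move=> _ /mapP[y yY ->] /=; have [s1 e1] := HY _ yY.
  by rewrite size_drop s1 -drop_wxor e1 drop_drop mulnS addKn mulnS.
- rewrite (@near_tries _ _ _ (@keepE j) Y n); last 2 first.
  + by rewrite sxr mulnS leq_addr.
  + by apply/allP => y yY; have [-> _] := HY _ yY; rewrite mulnS leq_addr.
  rewrite -addnA; congr (_ + (_ + _)).
    apply: eq_in_count => y yY; have [_ e1] := HY _ yY.
    rewrite -[take 4 y.1]cats0.
    have -> : wxor xr (take 4 y.1 ++ [::]) = take 4 (wxor xr y.1).
      rewrite cats0; elim: (4) (xr) (y.1) => [|m IHm] [|p u] [|q v] //=; by rewrite IHm.
    (* The test for the first light quarter already implies that quarter [j] is within its radius,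
       so restricting the lookup to that radius loses nothing. *)
    rewrite e1; case Qy: (Q j y.2); rewrite ?andbF // andbT.
    by move: Qy => /andP[/first_part_le].
  by apply: eq_bigr => i _; rewrite count_map.
- by rewrite size_drop sxr mulnS addKn.
- by rewrite addnS -addSn.
Qed.
End Hits.

(** Some quarter is within its radius, since otherwise the total weight would exceed [t]; asking for
    the first such quarter makes it unique. *)
Lemma radii_cover t z : size z = 16 -> wwt z <= t -> \sum_(i <- iota 0 4) first_part (radii t) i z = 1%N.
Proof.
move=> sz zt; rewrite unlock /= drop_drop /=.
have : wwt z = wwt (take 4 z) + (wwt (take 4 (drop 4 z)) + (wwt (take 4 (drop 8 z)) + wwt (take 4 (drop 12 z)))).
  rewrite -[in LHS](cat_take_drop 4 z) wwt_cat -[X in wwt X + _ = _]/(take 4 z); congr (_ + _).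
  rewrite -[in LHS](cat_take_drop 4 (drop 4 z)) wwt_cat drop_drop; congr (_ + _).
  rewrite -[in LHS](cat_take_drop 4 (drop 8 z)) wwt_cat drop_drop; congr (_ + _).
  by rewrite take_oversize // size_drop sz.
rewrite ?drop_drop /=.
move: (wwt (take 4 z)) (wwt (take 4 (drop 4 z))) (wwt (take 4 (drop 8 z))) (wwt (take 4 (drop 12 z))).
move=> p q r s e.
have : ~ [/\ t %/ 4 < p, (t - 1) %/ 4 < q, (t - 2) %/ 4 < r & (t - 3) %/ 4 < s].
  by case; lia.
by do 4 (case: (leqP _ _) => ? /=); rewrite ?addn0 // => -[]; split.
Qed.

Lemma hits_count a t x (Y : seq word) acc : size x = 16 -> all (fun y => size y == 16) Y ->
  count a (hits t (radii t) (tries 4 [seq (y, y) | y <- Y]) x acc) =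
  count (fun y => (wwt (wxor x y) <= t) && a (wwt (wxor x y))) Y + count a acc.
Proof.
move=> sx sY; rewrite /hits -[radii t in X in hits_from _ X]drop0 hits_from_count //; last first.
  by move=> _ /mapP[y yY ->]; rewrite drop0 (eqP (allP sY _ yY)).
congr (_ + _); elim: Y sY => [|y Y IH] /=; first by rewrite big1_idem.
move=> /andP[/eqP sy /IH <-]; rewrite big_split /=; congr (_ + _).
case: (leqP (wwt (wxor x y)) t) => zt /=; last by rewrite big1 // => i _; rewrite andbF.
have sz : size (wxor x y) = 16 by rewrite size_wxor sx sy.
case: (a _); last by rewrite big1 // => i _; rewrite andbF.
by rewrite -[RHS](radii_cover sz zt); apply: eq_bigr => i _; rewrite andbT.
Qed.

(** From here on [e] selects the code (false) or its shadow (true). *)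
Definition component (e : bool) (A : Type) (p : A * A) := if e then p.2 else p.1.
Definition offset (e : bool) := if e then wones else wzero.

Lemma wxor0 x : size x <= 16 -> wxor wzero x = x.
Proof.
rewrite /wzero; elim: (16) x => [|n IH] [|a x] //= sx; rewrite IH //.
Qed.

Definition is_word (x : word) := size x == 16.

Lemma is_word_xor x y : is_word x -> is_word y -> is_word (wxor x y).
Proof. by rewrite /is_word size_wxor => /eqP -> /eqP ->. Qed.

Definition pair_count (e : bool) (X Y : seq word) (r : nat) :=
  \sum_(x <- X) count (fun y => wwt (wxor (wxor (offset e) x) y) == r) Y.

Lemma pair_countC e X Y r : pair_count e X Y r = pair_count e Y X r.
Proof.
rewrite /pair_count; under eq_bigr do rewrite -sum1_count big_mkcond.
rewrite exchange_big; apply: eq_bigr => y _; rewrite -sum1_count [RHS]big_mkcond.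
by apply: eq_bigr => x _; rewrite -!wxorA [wxor x y]wxorC.
Qed.

Lemma join1_count e tc ts X Y acc r : all is_word X -> all is_word Y ->
  r <= component e (tc, ts) ->
  count (eqn r) (component e (join1 tc ts X Y acc)) = pair_count e X Y r + count (eqn r) (component e acc).
Proof.
move=> wX wY; have key x t acc' : is_word x -> r <= t ->
   count (eqn r) (hits t (radii t) (tries 4 [seq (y, y) | y <- Y]) x acc') =
   count (fun y => wwt (wxor x y) == r) Y + count (eqn r) acc'.
  move=> /eqP sx rt; rewrite hits_count //; congr (_ + _); apply: eq_count => y.
  by rewrite eqnE eq_sym; case: eqP => [->|]; rewrite ?rt ?andbF.
have fold (f : seq nat -> word -> seq nat) g acc' :
    (forall x a', is_word x -> count (eqn r) (f a' x) = g x + count (eqn r) a') ->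
    count (eqn r) (foldr (fun x a' => f a' x) acc' X) = \sum_(x <- X) g x + count (eqn r) acc'.
  move=> fE; elim: X wX => [|x X IH]; rewrite ?big_nil //.
  by move=> /andP[wx /IH IH']; rewrite big_cons /= fE // IH' addnA.
case: e => rt.
  apply: (fold (fun a' x => hits ts (radii ts) _ (wxor wones x) a')) => x a' wx.
  by rewrite key ?is_word_xor.
apply: (fold (fun a' x => hits tc (radii tc) _ x a')) => x a' wx.
by rewrite key // [offset _]/wzero wxor0 // (eqP wx).
Qed.

Lemma join_count e tc ts X Y acc r : all is_word X -> all is_word Y ->
  r <= component e (tc, ts) ->
  count (eqn r) (component e (join tc ts X Y acc)) = pair_count e X Y r + count (eqn r) (component e acc).
Proof. by rewrite /join; case: ifP => _ wX wY rt; rewrite join1_count // pair_countC. Qed.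

(** * Subsets of size k as subsequences *)

Fixpoint subs (T : Type) (k : nat) (s : seq T) : seq (seq T) :=
  match k, s with
  | 0, _ => [:: [::]]
  | _, [::] => [::]
  | k'.+1, x :: s' => [seq x :: t | t <- subs k' s'] ++ subs k s'
  end.

Lemma subs0 T (s : seq T) : subs 0 s = [:: [::]]. Proof. by case: s. Qed.

Lemma subsS T k x (s : seq T) : subs k.+1 (x :: s) = [seq x :: t | t <- subs k s] ++ subs k.+1 s.
Proof. by []. Qed.

Lemma subs_map T T' (f : T -> T') k s : subs k (map f s) = map (map f) (subs k s).
Proof.
elim: s k => [|x s IH] [|k] //=; rewrite !IH map_cat -!map_comp; congr (_ ++ _).
Qed.

Lemma size_subs (T : eqType) k (s t : seq T) : t \in subs k s -> size t = k.
Proof.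
elim: s k t => [|x s IH] [|k] t //=; rewrite ?inE //; try by move=> /eqP ->.
by rewrite mem_cat => /orP[/mapP[u /IH <- ->]|/IH].
Qed.

Lemma mem_subs (T : eqType) k (s t : seq T) : uniq s ->
  (t \in subs k s) = subseq t s && (size t == k).
Proof.
elim: s k t => [|x s IH] [|k] t /=; rewrite ?inE.
- by case: t.
- by case: t.
- by move=> _; case: t => [|y t] //=; rewrite andbF.
move=> /andP[xs us]; rewrite mem_cat IH //.
case: t => [|y t] /=.
  by rewrite andbF orbF; apply/negbTE/negP => /mapP[].
have -> : (y :: t \in [seq x :: t0 | t0 <- subs k s]) = (y == x) && (t \in subs k s).
  apply/mapP/andP => [[u us' [-> ->]]|[/eqP -> ts]]; first by rewrite eqxx.
  by exists t.
rewrite IH //; case: eqP => [->|_] //=; rewrite eqSS.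
case H : (subseq t s) => /=.
  case: (size t == k); rewrite ?andbF //.
case: (boolP (subseq (x :: t) s)) => // /mem_subseq /(_ x); rewrite mem_head (negbTE xs).
by move=> /(_ isT).
Qed.

Lemma uniq_subs (T : eqType) k (s : seq T) : uniq s -> uniq (subs k s).
Proof.
elim: s k => [|x s IH] [|k] //= /andP[xs us].
rewrite cat_uniq map_inj_uniq ?IH //; last by move=> a b [].
rewrite /= andbT; apply/hasPn => t; rewrite mem_subs // => /andP[ts _].
apply/negP => /mapP[u _ tE]; move: ts; rewrite tE => /mem_subseq /(_ x).
by rewrite mem_head (negbTE xs) => /(_ isT).
Qed.

(** A subsequence of a list without repetitions is determined by its set of entries. *)
Lemma sum_subs n k (F : {set 'I_n} -> nat) :
  \sum_(A : {set 'I_n} | #|A| == k) F A = \sum_(t <- subs k (enum 'I_n)) F [set x in t].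
Proof.
rewrite -(big_map (fun t => [set x in t]) xpredT F) -[LHS]big_filter.
have ue := enum_uniq 'I_n.
apply: perm_big; apply: uniq_perm.
- by rewrite filter_uniq // index_enum_uniq.
- rewrite map_inj_in_uniq ?uniq_subs // => s t; rewrite !mem_subs //.
  move=> /andP[/(subseq_uniqP ue) -> _] /andP[/(subseq_uniqP ue) -> _] /setP e.
  apply: eq_in_filter => i iI; have mE u : (i \in [seq x0 <- enum 'I_n | x0 \in u]) = (i \in u) by rewrite mem_filter iI andbT.
  by have := e i; rewrite !in_set !mE.
move=> A; rewrite mem_filter mem_index_enum andbT; apply/eqP/mapP => [Ak|[t]].
  exists (enum A); last by apply/setP => i; rewrite inE mem_enum.
  rewrite mem_subs // -cardE Ak eqxx andbT.
  by rewrite [enum 'I_n]enumT; apply: filter_subseq.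
rewrite mem_subs // => /andP[ts /eqP <-] ->.
by rewrite cardsE; apply/card_uniqP; apply: subseq_uniq ts ue.
Qed.

(** This is the decomposition behind Vandermonde's identity: i elements come from the first list and
    k - i from the second. *)
Lemma sum_subs_cat T k (s1 s2 : seq T) (f : seq T -> nat) :
  \sum_(t <- subs k (s1 ++ s2)) f t =
  \sum_(i <- iota 0 k.+1) \sum_(t1 <- subs i s1) \sum_(t2 <- subs (k - i) s2) f (t1 ++ t2).
Proof.
elim: s1 k f => [|x s1 IH] k f.
  rewrite /= big_cons /= big_seq1 subn0 /= -[LHS]addn0; congr (_ + _).
  rewrite big_seq big1 // => i; rewrite mem_iota; case: i => // i _.
  by rewrite big_nil.
case: k => [|k]; first by rewrite /= !big_seq1 subs0 big_seq1.
have split0 (G : nat -> nat) :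
    \sum_(i <- iota 0 k.+2) G i = G 0 + \sum_(i <- iota 0 k.+1) G i.+1.
  by rewrite -[iota 0 k.+2]/(0 :: iota (1 + 0) k.+1) iotaDl big_cons big_map.
rewrite cat_cons subsS big_cat big_map !IH !split0 !subs0 !big_seq1.
rewrite [LHS]addnCA; congr (_ + _); rewrite -big_split; apply: eq_bigr => i _.
by rewrite subsS big_cat big_map subSS.
Qed.

Definition wsum := foldl wxor.

Lemma sums_fromE k L a acc : sums_from k L a acc = [seq wsum a t | t <- subs k L] ++ acc.
Proof.
by elim: L k a acc => [|x L IH] [|k] a acc //=; rewrite !IH map_cat -map_comp catA.
Qed.

Lemma tree_sums_scons t1 t2 L a acc :
  tree_sums_from (scons t1 t2) L a acc = tree_sums_from (SCons t1 t2) L a acc.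
Proof. by case: t1 t2 => [||? ?] [||? ?] //=; case: L. Qed.

Lemma tree_sums_fromE k st L a acc :
  tree_sums_from (subset_tree k st (size L)) L a acc =
  [seq wsum a [seq nth [::] L i | i <- t] | t <- subs k (iota 0 (size L)) & nth false st (sumn t)] ++ acc.
Proof.
elim: L k st a acc => [|x L IH] [|k] st a acc.
- by rewrite /= -nth0; case: (nth _ _ _).
- by [].
- by rewrite /= -nth0; case: (nth _ _ _).
rewrite [subset_tree _ _ _]/= tree_sums_scons /= !IH.
rewrite -[iota 1 _]/(iota (1 + 0) (size L)) iotaDl !subs_map filter_cat map_cat -catA.
(* Renumbering the positions of the tail raises each index by 1, hence a sum of j indices by j; this
   is why [subset_tree] drops j entries of the table. *)
have shift j m t : t \in subs j (iota 0 m) -> nth false (drop j st) (sumn t) = nth false st (sumn (map (addn 1) t)).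
  move=> /size_subs <-; rewrite nth_drop; congr nth.
  by elim: t => //= y t IHt; rewrite -IHt; lia.
congr (_ ++ _).
  rewrite -map_comp filter_map -map_comp.
  rewrite (eq_in_filter (a2 := preim (cons 0 \o map (addn 1)) (fun t => nth false st (sumn t)))); last first.
    by move=> t /shift ->.
  by apply: eq_map => t /=; congr wsum; rewrite -map_comp.
rewrite filter_map -map_comp; congr (_ ++ _).
rewrite (eq_in_filter (a2 := preim (map (addn 1)) (fun t => nth false st (sumn t)))); last first.
  by move=> t /shift ->.
by apply: eq_map => t /=; congr wsum; rewrite -map_comp.
Qed.

(** * Weight enumerators from shadows *)

Section WeightEnumerators.
Local Open Scope ring_scope.

(** * Characters and Krawtchouk polynomials *)

Lemma F2P (x : 'F_2) : x = 0 \/ x = 1.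
Proof. by case: x => [[|[|m]] Hm] //; [left|right]; apply: val_inj. Qed.

Definition sgn (x : 'F_2) : Z := if x == 0 then 1 else -1.

Lemma sgnD x y : sgn (x + y) = sgn x * sgn y.
Proof. by case: (F2P x) => ->; case: (F2P y) => ->. Qed.

Lemma inner_productDr n (x y z : 'rV['F_2]_n) :
  inner_product x (y + z) = inner_product x y + inner_product x z.
Proof. by rewrite -big_split; apply: eq_bigr => i _; rewrite mxE mulrDr. Qed.

Lemma inner_productC n (x y : 'rV['F_2]_n) : inner_product x y = inner_product y x.
Proof. by apply: eq_bigr => i _; rewrite mulrC. Qed.

Lemma inner_productDl n (x y z : 'rV['F_2]_n) :
  inner_product (x + y) z = inner_product x z + inner_product y z.
Proof. by rewrite !(inner_productC _ z) inner_productDr. Qed.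

Lemma hamming_weight_sum n (x : 'rV['F_2]_n) : hamming_weight x = (\sum_i (x 0%R i != 0%R))%N.
Proof. by rewrite /hamming_weight -sum1dep_card big_mkcond; apply: eq_bigr => i _; case: (_ != _). Qed.

Definition krawtchouk (n j w : nat) : Z := ((1 - 'X) ^+ w * (1 + 'X) ^+ (n - w) : {poly Z})`_j.

(** The sum over all vectors factors over the coordinates: a coordinate contributes 1 - X if it lies
    in the support of [c], and 1 + X otherwise. *)
Lemma sgn_inner_gf n (c : 'rV['F_2]_n) :
  \sum_(v : 'rV['F_2]_n) (sgn (inner_product c v))%:P * 'X^(hamming_weight v)
  = (1 - 'X) ^+ hamming_weight c * (1 + 'X) ^+ (n - hamming_weight c) :> {poly Z}.
Proof.
pose G (i : 'I_n) (b : 'F_2) : {poly Z} := (sgn (c 0 i * b))%:P * 'X^(b != 0).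
have rowK : cancel (fun v : 'rV['F_2]_n => [ffun i => v 0 i]) (fun f : {ffun 'I_n -> 'F_2} => \row_i f i).
  by move=> v; apply/rowP => i; rewrite mxE ffunE.
have ffunK' : cancel (fun f : {ffun 'I_n -> 'F_2} => \row_i f i) (fun v : 'rV['F_2]_n => [ffun i => v 0 i]).
  by move=> f; apply/ffunP => i; rewrite ffunE mxE.
rewrite (reindex (fun f : {ffun 'I_n -> 'F_2} => \row_i f i)) /=; last first.
  by exists (fun v : 'rV['F_2]_n => [ffun i => v 0 i]) => v _; [exact: ffunK'|exact: rowK].
transitivity (\sum_(f : {ffun 'I_n -> 'F_2}) \prod_i G i (f i)).
  apply: eq_bigr => f _; rewrite big_split /= -rmorph_prod; congr (_%:P * _).
    rewrite /inner_product (big_morph sgn sgnD (erefl : sgn 0 = 1)).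
    by apply: eq_bigr => i _; rewrite mxE.
  by rewrite prodrXr hamming_weight_sum; congr ('X^_); apply: eq_bigr => i _; rewrite mxE.
rewrite -bigA_distr_bigA /=.
have GE i : \sum_(b : 'F_2) G i b = if c 0 i != 0 then 1 - 'X else 1 + 'X.
  rewrite (bigD1 0) //= (bigD1 1) //= big1 ?addr0; last first.
    by move=> b /andP[/negbTE b0 /negbTE b1]; case: (F2P b) => bE; rewrite bE eqxx in b0 b1.
  rewrite /G mulr0 mulr1 /sgn /=.
  by case: (F2P (c 0 i)) => -> /=; rewrite ?polyCN polyC1 ?mulN1r ?mul1r.
rewrite (eq_bigr _ (fun i _ => GE i)) (bigID (fun i => c 0 i != 0)) /=.
rewrite (eq_bigr (fun=> 1 - 'X)); last by move=> i ->.
rewrite [X in _ * X](eq_bigr (fun=> 1 + 'X)); last by move=> i /negbTE ->.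
rewrite !prodr_const -cardsE; congr (_ ^+ _ * _ ^+ _).
have := cardC [set i | c 0 i != 0]; rewrite card_ord /hamming_weight => nE.
transitivity #|[predC [set i | c 0 i != 0]]|; last by move: nE; lia.
by apply: eq_card => i; rewrite !inE.
Qed.

Lemma krawtchouk_sum n (c : 'rV['F_2]_n) j :
  \sum_(v : 'rV['F_2]_n | hamming_weight v == j) sgn (inner_product c v)
  = krawtchouk n j (hamming_weight c).
Proof.
rewrite /krawtchouk -sgn_inner_gf coef_sum big_mkcond; apply: eq_bigr => v _.
by rewrite coefCM coefXn eq_sym; case: eqP => _; rewrite ?mulr1 ?mulr0.
Qed.

(** * MacWilliams identities for a self-dual code and its cosets *)

Section MacWilliams.
Variables (n : nat) (C : binary_code n).
Hypothesis C_sd : self_dual C.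

Lemma self_dualP y : reflect (forall c, c \in C -> inner_product y c = 0) (y \in C).
Proof.
rewrite C_sd inE; apply: (iffP forallP) => [H c cC|H c].
  by have /implyP/(_ cC)/eqP := H c.
by apply/implyP => cC; rewrite H.
Qed.

(** Orthogonality of characters. If [y] is outside C, which is its own dual, some codeword [c0] has
    inner product 1 with [y], and translation by [c0] reverses the sign of the sum. *)
Lemma character_sum (y : 'rV['F_2]_n) :
  \sum_(c in C) sgn (inner_product c y) = if y \in C then #|C|%:R else 0.
Proof.
case: ifPn => [yC|yC].
  rewrite (eq_bigr (fun=> 1)) ?sumr_const // => c cC.
  by rewrite (elimT (self_dualP c) cC y yC).
have [c0 c0C c0y] : exists2 c, c \in C & inner_product c y = 1.
  move: yC; rewrite C_sd inE => /forallPn[c]; rewrite negb_imply => /andP[cC nz].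
  by exists c => //; rewrite inner_productC; case: (F2P (inner_product y c)) nz => ->.
set S := LHS; suff : S = - S by lia.
rewrite {1}/S (reindex_inj (addrI c0)) /= -sumrN.
apply: eq_big => [c|c _]; first by rewrite rpredDl.
by rewrite inner_productDl sgnD c0y /sgn /= mulN1r.
Qed.

(** With [u] = 0 the right side counts codewords of weight [j]; in general it counts the vectors of
    weight [j] in the coset of [u]. The proof expands the Krawtchouk value as a character sum and
    exchanges the sums. *)
Lemma macwilliams (u : 'rV['F_2]_n) (j : nat) :
  \sum_(c in C) sgn (inner_product c u) * krawtchouk n j (hamming_weight c)
  = #|C|%:R * #|[set v | hamming_weight v == j & u + v \in C]|%:R.
Proof.
under eq_bigr => c _ do rewrite -krawtchouk_sum mulr_sumr.
rewrite exchange_big /=.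
under eq_bigr => v _ do under eq_bigr => c _ do rewrite -sgnD -inner_productDr.
under eq_bigr => v _ do rewrite character_sum.
rewrite -big_mkcondr /= sumr_const -[LHS]mulr_natr; congr (_ * _%:R).
by apply: eq_card => v; rewrite !inE.
Qed.

End MacWilliams.

(** * Computable values of Krawtchouk polynomials *)

Definition mul_1X (s : Z) (l : seq Z) : seq Z := [seq Z.add x.1 (Z.mul s x.2) | x <- zip l (Z0 :: l)].
(** These are the coefficients of the generating function truncated after degree [m]; the truncation
    is compatible with each multiplication by 1 + X or 1 - X. *)
Definition kraw_row (m n w : nat) : seq Z :=
  iter (n - w) (mul_1X (Zpos 1)) (iter w (mul_1X (Zneg 1)) (Zpos 1 :: nseq m Z0)).

Lemma mul_1XP m s (l : seq Z) (p : {poly Z}) :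
  size l = m -> (forall j, (j < m)%N -> p`_j = l`_j) ->
  size (mul_1X s l) = m /\ forall j, (j < m)%N -> ((1 + s%:P * 'X) * p)`_j = (mul_1X s l)`_j.
Proof.
move=> sl pl; have sz : size (zip l (0 :: l)) = m by rewrite size_zip /= sl; apply/minn_idPl.
split=> [|j jm]; first by rewrite size_map.
rewrite mulrDl mul1r -mulrA coefD coefCM coefXM (nth_map (0, 0)) ?sz //.
rewrite nth_zip_cond sz jm /= pl //; case: j jm => [|j] jm //=.
by rewrite pl // ltnW.
Qed.

Lemma kraw_rowP m n w j : (j <= m)%N -> krawtchouk n j w = (kraw_row m n w)`_j.
Proof.
rewrite /krawtchouk /kraw_row -ltnS.
suff H k (s : Z) l (p : {poly Z}) :
    size l = m.+1 -> (forall i, (i < m.+1)%N -> p`_i = l`_i) ->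
    size (iter k (mul_1X s) l) = m.+1 /\
    forall i, (i < m.+1)%N -> ((1 + s%:P * 'X) ^+ k * p)`_i = (iter k (mul_1X s) l)`_i.
  have [|i _|s0 e0] := H w (-1) (1 :: nseq m 0) 1.
  - by rewrite /= size_nseq.
  - by rewrite coef1; case: i => //= i; rewrite nth_nseq if_same.
  have [s1 e1] := H (n - w)%N 1 _ _ s0 e0.
  move=> /e1 <-; rewrite mulr1 mulrC polyCN polyC1 mulN1r mul1r //.
move=> sl pl; elim: k => [|k [sk ek]]; first by split=> // i im; rewrite mul1r pl.
have [s' e'] := mul_1XP s sk ek.
by split=> // i im; rewrite exprS -mulrA e'.
Qed.

Lemma F2_addvv m n (x : 'M['F_2]_(m, n)) : x + x = 0.
Proof. by apply/matrixP => i j; rewrite !mxE; case: (F2P (x i j)) => ->; apply: val_inj. Qed.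

Lemma hamming_weight_max (x : 'rV['F_2]_92) : (hamming_weight x < 93)%N.
Proof. by rewrite ltnS -[leqRHS](card_ord 92) /hamming_weight max_card. Qed.

Lemma hamming_weight0 n : hamming_weight (0 : 'rV['F_2]_n) = 0%N.
Proof. by rewrite hamming_weight_sum big1 // => i _; rewrite mxE eqxx. Qed.

Lemma hamming_weight_compl n (x : 'rV['F_2]_n) :
  hamming_weight (const_mx 1 + x) = (n - hamming_weight x)%N.
Proof.
have H : (hamming_weight (const_mx 1 + x)%R + hamming_weight x = n)%N.
  rewrite !hamming_weight_sum -big_split /= -[RHS](card_ord n) -sum1_card.
  by apply: eq_big => [i|i _]; rewrite ?inE ?mxE //; case: (F2P (x 0%R i)) => ->.
lia.
Qed.

(** * Combining the identities of the code and its shadow *)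

Section Enumerator.
Variables (C : binary_code 92) (u : 'rV['F_2]_92).
Hypothesis C_sd : self_dual C.
Hypothesis C_card : #|C|%:R = 2 ^+ 46 :> Z.
Hypothesis C_shadow : forall c, c \in C ->
  ~~ odd (hamming_weight c) /\ sgn (inner_product c u) = (-1) ^+ (hamming_weight c)./2.
Hypothesis C_min : forall c, c \in C -> c != 0 -> (16 <= hamming_weight c)%N.

Let A w : Z := (weight_count C w)%:R.
Let S j : Z := #|[set v | hamming_weight v == j & u + v \in C]|%:R.

Lemma sum_by_weight (f : nat -> Z) :
  \sum_(c in C) f (hamming_weight c) = \sum_(w <- iota 0 93) A w * f w.
Proof.
rewrite -[iota 0 93]/(index_iota 0 93) big_mkord.
rewrite (partition_big (fun c => Ordinal (hamming_weight_max c)) xpredT) //=.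
apply: eq_bigr => w _; rewrite (eq_bigr (fun=> f w)); last by move=> c /andP[_ /eqP <-].
rewrite sumr_const -[LHS]mulr_natl; congr (_%:R * _).
by apply: eq_card => c; rewrite !inE.
Qed.

(** All weights are even, so the all-ones word is orthogonal to C and lies in its dual, C itself.
    Complementation then makes the weight distribution symmetric. *)
Lemma ones_in : const_mx 1 \in C.
Proof.
apply/(self_dualP C_sd) => c /C_shadow[ev _].
rewrite /inner_product.
have -> : \sum_i (const_mx 1 : 'rV_92) 0 i * c 0 i = (hamming_weight c)%:R :> 'F_2.
  rewrite hamming_weight_sum natr_sum; apply: eq_bigr => i _.
  by rewrite mxE mul1r; case: (F2P (c 0 i)) => ->.
rewrite -[hamming_weight c]odd_double_half (negbTE ev) add0n -muln2 natrM.
by rewrite [2%:R](_ : _ = 0) ?mulr0 //; apply: val_inj.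
Qed.

Lemma A_sym w : (w <= 92)%N -> A (92 - w)%N = A w.
Proof.
move=> w92; congr _%:R; rewrite /weight_count.
rewrite -(card_imset _ (addrI (const_mx 1))); apply: eq_card => c.
apply/imsetP/idP => [[d]|]; rewrite !inE.
  move=> /andP[dC /eqP dw] ->; rewrite rpredD ?ones_in //= hamming_weight_compl dw.
  by rewrite subKn.
move=> /andP[cC /eqP cw]; exists (const_mx 1 + c).
  by rewrite !inE rpredD ?ones_in //= hamming_weight_compl cw.
by rewrite addrA F2_addvv add0r.
Qed.

Lemma A0 : A 0 = 1.
Proof.
rewrite /A /weight_count (_ : [set x in C | _] = [set 0]) ?cards1 //.
apply/setP => c; rewrite !inE; apply/andP/eqP => [[cC /eqP c0]|->].
  by apply/eqP; apply: contraT => /(C_min cC); rewrite c0.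
by rewrite mem0v hamming_weight0.
Qed.

Lemma A_zero w : [|| odd w, 0 < w < 16 | 76 < w < 92]%N -> A w = 0.
Proof.
have A0' v : (odd v || (0 < v < 16))%N -> A v = 0.
  move=> H; rewrite /A /weight_count (_ : [set x in C | _] = set0) ?cards0 //.
  apply/setP => c; rewrite !inE; apply/negP => /andP[cC /eqP cv]; case/orP: H => H.
    by have [/negP[]] := C_shadow cC; rewrite cv.
  have c0 : c != 0 by apply: contraTneq H => c0; rewrite -cv c0 hamming_weight0.
  by have := C_min cC c0; rewrite cv; lia.
move=> H; case: (leqP w 76) => w76; first by apply: A0'; lia.
case: (leqP w 92) => w92; last by apply: A0'; lia.
by rewrite -A_sym //; apply: A0'; lia.
Qed.

(** [p] holds multipliers for the identities of degrees 0 to 14, and [e] the sign of the shadow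
    identities. The resulting test function [g] is to vanish at all possible weights except 0 and
    92, where it is [E], and [T] and 92 - [T], where it is [D]. *)
Variables (p : seq Z) (e : bool) (T : nat) (D E : Z).
Hypothesis p_size : size p = 15%N.
Let f w : Z := foldr (fun x a => Z.add (Z.mul x.1 x.2) a) Z0 (zip p (kraw_row 14 92 w)).
Let g w : Z := ((1 + (-1) ^+ e * (-1) ^+ w./2) * f w)%R.

Lemma fE w : f w = \sum_(j < 15) p`_j * krawtchouk 92 j w.
Proof.
have sk : size (kraw_row 14 92 w) = 15.
  have sm s l : size (mul_1X s l) = size l.
    by rewrite size_map size_zip; apply/minn_idPl.
  rewrite /kraw_row; elim: (92 - w)%N => [|k IH]; last by rewrite iterS sm.
  by elim: w => [|k IH]; rewrite ?iterS ?sm //= size_nseq.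
transitivity (\sum_(x <- zip p (kraw_row 14 92 w)) x.1 * x.2).
  by rewrite /f unlock /reducebig; elim: (zip _ _) => //= x s ->.
rewrite (big_nth (0, 0)) size_zip p_size sk big_mkord.
by apply: eq_bigr => j _; rewrite nth_zip ?p_size //= (@kraw_rowP 14) // -ltnS.
Qed.

(** The identity for C and the signed one for its coset by [u] are added degree by degree; on C the
    character of [u] is (-1)^(w/2), which gives the first factor of [g]. *)
Lemma weighted_macwilliams :
  \sum_(w <- iota 0 93) A w * g w = 2 ^+ 46 * \sum_(j < 15) p`_j * (A j + (-1) ^+ e * S j).
Proof.
rewrite -sum_by_weight.
transitivity (\sum_(j < 15) p`_j * (\sum_(c in C) sgn (inner_product c 0) * krawtchouk 92 j (hamming_weight c)
    + (-1) ^+ e * \sum_(c in C) sgn (inner_product c u) * krawtchouk 92 j (hamming_weight c))).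
  under [RHS]eq_bigr => j _ do rewrite mulr_sumr -big_split mulr_sumr.
  rewrite exchange_big /=; apply: eq_bigr => c cC.
  have [_ ->] := C_shadow cC.
  have -> : inner_product c 0 = 0 by rewrite /inner_product big1 // => i _; rewrite mxE mulr0.
  rewrite /g fE mulr_sumr; apply: eq_bigr => j _.
  by rewrite (_ : sgn 0 = 1) // [_ * (_ ^+ _ * _)]mulrA -mulrDl mulrCA.
rewrite mulr_sumr; apply: eq_bigr => j _.
rewrite !(macwilliams C_sd) C_card.
have -> : #|[set v | hamming_weight v == j & 0 + v \in C]| = weight_count C j.
  by apply: eq_card => v; rewrite !inE add0r andbC.
by rewrite -/(A j) -/(S j) [_ * (2 ^+ 46 * _)]mulrCA -mulrDr mulrCA.
Qed.

Hypothesis T_ok : [&& 0 < T, T < 92 & T != 92 - T]%N.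
Hypothesis p_ok : all (fun w => [|| odd w, 0 < w < 16, 76 < w < 92 |
    (g w == if (w == T) || (w == 92 - T) then D else if (w == 0) || (w == 92) then E else 0%R)])%N (iota 0 93).

(** Only the weights 0, 92, [T] and 92 - [T] survive on the left; complementation pairs them, whence
    the factor 2. *)
Lemma enumerator_coef : 2 * (D * A T + E) = 2 ^+ 46 * \sum_(j < 15) p`_j * (A j + (-1) ^+ e * S j).
Proof.
rewrite -weighted_macwilliams.
have H : {in iota 0 93, forall w, A w * g w = A w *
   (if (w == T) || (w == 92 - T)%N then D else if (w == 0%N) || (w == 92%N) then E else 0)}.
  move=> w /(allP p_ok) /or4P[h|h|h|/eqP -> //]; by rewrite A_zero ?mul0r ?h ?orbT.
rewrite (eq_big_seq _ H) -[iota 0 93]/(index_iota 0 93) big_mkord.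
have [o1 o2 o3 o4] : [/\ 0 < 93, 92 < 93, T < 93 & 92 - T < 93]%N by split; lia.
rewrite (bigD1 (Ordinal o1)) //= (bigD1 (Ordinal o2)) //= (bigD1 (Ordinal o3)) //=; last first.
  by rewrite -!val_eqE /=; lia.
rewrite (bigD1 (Ordinal o4)) /=; last by rewrite -!val_eqE /=; lia.
rewrite big1 ?addr0; last first.
  move=> i; rewrite -!val_eqE /= => H'.
  rewrite ifN; last lia.
  by rewrite ifN ?mulr0 //; lia.
have -> : ((0 == T) || (0 == 92 - T))%N = false by lia.
have -> : ((92 == T) || (92 == 92 - T))%N = false by lia.
rewrite !eqxx /= orbT /=.
rewrite (A_sym (w := T)); last lia.
rewrite -[92%N]/(92 - 0)%N A_sym // A0.
ring.
Qed.

End Enumerator.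

(* Solutions p of (1 + (-1)^e (-1)^(w/2)) (sum_j p_j K_j(w)) = 0 for all even w from 16 to 76
   other than T and 92 - T, where K_j are the Krawtchouk polynomials and T = 16, 18, 20. *)
Definition certificate16 : seq Z :=
  [:: 1938; 0; 1122; 0; 306; 0; 170; 0; 34; 0; 18; 0; 2; 0; 1]%coqZ.
Definition certificate18 : seq Z :=
  [:: 21850; 0; 7810; 0; 2746; 0; 810; 0; 234; 0; 50; 0; 10; 0; 1]%coqZ.
Definition certificate20 : seq Z :=
  [:: 597974; 0; 182534; 0; 52918; 0; 12126; 0; 2694; 0; 278; 0; 38; 0; -13]%coqZ.

(** Among the degrees up to 14 the code contributes only through weight 0 and the shadow only
    through weights 10 and 14, so each certificate expresses one coefficient by [a] and [b]. *)
Lemma enumerator_from_shadow (C : binary_code 92) (u : 'rV['F_2]_92) (a b : nat) :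
  self_dual C -> #|C|%:R = 2 ^+ 46 :> Z ->
  (forall c, c \in C ->
    ~~ odd (hamming_weight c) /\ sgn (inner_product c u) = (-1) ^+ (hamming_weight c)./2) ->
  (forall c, c \in C -> c != 0 -> (16 <= hamming_weight c)%N) ->
  (forall j, (j < 15)%N -> ~~ odd j -> #|[set v | hamming_weight v == j & u + v \in C]|
     = if j == 10%N then a else if j == 14%N then b else 0%N) ->
  [/\ (weight_count C 16)%:R = (4692 + (72 * a%:R + 4 * b%:R))%coqZ :> Z,
      (weight_count C 18)%:R = (174800 - (400 * a%:R + 8 * b%:R))%coqZ :> Z &
      (weight_count C 20)%:R = (2425488 + 1112 * a%:R - 52 * b%:R)%coqZ :> Z].
Proof.
move=> C_sd C_card C_shadow C_min S_eq.
have A_0 := A0 C_min.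
have A_z := A_zero C_sd C_card C_shadow C_min.
have sumE (p : seq Z) (e : bool) : all (fun j => p`_j == 0) [:: 1; 3; 5; 7; 9; 11; 13]%N ->
    \sum_(j < 15) p`_j * ((weight_count C j)%:R + (-1) ^+ e *
         #|[set v | hamming_weight v == j & u + v \in C]|%:R)
    = p`_0 + (-1) ^+ nat_of_bool e * (p`_10 * a%:R + p`_14 * b%:R).
  move=> /allP pz; have {}pz j : j \in [:: 1; 3; 5; 7; 9; 11; 13]%N -> p`_j = 0 by move=> /pz/eqP.
  rewrite -(big_mkord xpredT (fun j => p`_j * ((weight_count C j)%:R + (-1) ^+ e *
         #|[set v | hamming_weight v == j & u + v \in C]|%:R))) unlock /=.
  rewrite (pz 1%N) // (pz 3%N) // (pz 5%N) // (pz 7%N) // (pz 9%N) // (pz 11%N) // (pz 13%N) // !mul0r A_0.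
  rewrite (A_z 2%N) // (A_z 4%N) // (A_z 6%N) // (A_z 8%N) // (A_z 10%N) // (A_z 12%N) // (A_z 14%N) // !S_eq //=.
  set x := p`_0; set y := p`_10; set z := p`_14; set t := (-1) ^+ e; set a' := a%:R; set b' := b%:R.
  by rewrite !mulr0 !addr0 !add0r !mulr1 mulrDr ![t * (_ * _)]mulrCA.
have coef p e T D E h h1 h2 h3 := etrans (@enumerator_coef C u C_sd C_card C_shadow C_min p e T D E h1 h2 h3)
  (congr1 _ (sumE p e h)).
have e46 : 2 ^+ 46 = 70368744177664%coqZ by [].
split.
(* The two constants are the values of the test function at the target weight and at 0, here 2^43
   and 3060 times 2^43. The sign [e] is chosen so that the factor 1 + (-1)^(e + w/2) is 2 at the
   target. *)
- have /(_ isT erefl isT) H := coef certificate16 false 16%N 8796093022208%coqZ (26916044647956480)%coqZ.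
  have {}H := H ltac:(by vm_compute).
  rewrite e46 /certificate16 /= ?expr0 ?expr1 in H.
  by move: (weight_count C 16)%:R a%:R b%:R H => x y z; lia.
(* Since 18 is 2 modulo 4, the sign is reversed; the factor then vanishes at weights 0 and 92, so
   [E] is 0. *)
- have /(_ isT erefl isT) H := coef certificate18 true 18%N 4398046511104%coqZ (0)%coqZ.
  have {}H := H ltac:(by vm_compute).
  rewrite e46 /certificate18 /= ?expr0 ?expr1 in H.
  by move: (weight_count C 18)%:R a%:R b%:R H => x y z; lia.
- have /(_ isT erefl isT) H := coef certificate20 false 20%N 8796093022208%coqZ (-295478356802011136)%coqZ.
  have {}H := H ltac:(by vm_compute).
  rewrite e46 /certificate20 /= ?expr0 ?expr1 in H.
  by move: (weight_count C 20)%:R a%:R b%:R H => x y z; lia.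
Qed.

End WeightEnumerators.

(** * Counting words by type *)

Definition octal_bits (a : oct) : seq bool :=
  match a with
  | O0 => [:: false; false; false] | O1 => [:: false; false; true]
  | O2 => [:: false; true; false] | O3 => [:: false; true; true]
  | O4 => [:: true; false; false] | O5 => [:: true; false; true]
  | O6 => [:: true; true; false] | O7 => [:: true; true; true]
  end.

Definition coord (x : word) (j : nat) : bool := nth false (octal_bits (nth O0 x (j %/ 3))) (j %% 3).

Definition wvec (x : word) : 'rV['F_2]_46 := \row_j (coord x j)%:R%R.

(** The padding bits must be zero because [wwt] counts them while [wvec] does not see them. *)
Definition good (x : word) := [&& is_word x, ~~ coord x 46 & ~~ coord x 47].

Lemma natr_addb (b c : bool) : ((b (+) c)%:R = b%:R + c%:R :> 'F_2)%R.
Proof. by case: b; case: c; apply: val_inj. Qed.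

Lemma natrb_eq0 (b : bool) : (b%:R != 0 :> 'F_2)%R = b.
Proof. by case: b. Qed.

Lemma coord_xor x y j : size x = size y -> coord (wxor x y) j = coord x j (+) coord y j.
Proof.
move=> s; rewrite /coord; have -> : nth O0 (wxor x y) (j %/ 3) = oxor (nth O0 x (j %/ 3)) (nth O0 y (j %/ 3)).
  by elim: x y s (j %/ 3) => [|a x IH] [|b y] //= => [_ i|[/IH s] [|i]] //=; rewrite nth_nil.
by move: (nth _ x _) (nth _ y _) (j %% 3) => a b [|[|[|m]]]; case: a; case: b => //=; rewrite ?nth_nil.
Qed.

Lemma wvec_xor x y : size x = size y -> wvec (wxor x y) = (wvec x + wvec y)%R.
Proof. by move=> s; apply/rowP => j; rewrite !mxE coord_xor // natr_addb. Qed.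

Lemma coordS a x j : coord (a :: x) (j + 3) = coord x j.
Proof. by rewrite /coord divnDr // modnDr /= addn1. Qed.

Lemma wwt_coord x : wwt x = \sum_(0 <= j < 3 * size x) coord x j.
Proof.
elim: x => [|a x IH] /=; first by rewrite big_geq.
rewrite (@big_cat_nat _ _ _ 3) //=; last by rewrite mulnS leq_addr.
rewrite -[X in _ + \sum_(X <= _ < _) _]add0n big_addn.
have -> : 3 * (size x).+1 - 3 = 3 * size x by lia.
congr (_ + _).
  by rewrite unlock; case: a.
by rewrite IH; apply: eq_bigr => j _; rewrite coordS.
Qed.

Lemma good_word x : good x -> is_word x. Proof. by case/and3P. Qed.

Lemma wwt_weight x : good x -> wwt x = hamming_weight (wvec x).
Proof.
case/and3P => /eqP s /negbTE c46 /negbTE c47.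
rewrite wwt_coord s hamming_weight_sum -[3 * 16]/48 2?big_nat_recr //= c46 c47 !addn0 big_mkord.
by apply: eq_bigr => j _; rewrite mxE natrb_eq0.
Qed.

Lemma good_xor x y : good x -> good y -> good (wxor x y).
Proof.
case/and3P => wx x1 x2 /and3P[wy y1 y2]; have s : size x = size y by rewrite (eqP wx) (eqP wy).
by rewrite /good is_word_xor //= !coord_xor // (negbTE x1) (negbTE x2) (negbTE y1) (negbTE y2).
Qed.

Lemma good_offset e : good (offset e). Proof. by case: e. Qed.

Definition offset_vec (e : bool) : 'rV['F_2]_46 := if e then const_mx 1%R else 0%R.

Lemma wvec_offset e : wvec (offset e) = offset_vec e.
Proof.
apply/rowP => j; rewrite mxE; case: e; rewrite !mxE; last first.
  suff -> : coord (offset false) j = false by [].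
  by rewrite /coord nth_nseq if_same; case: (_ %% _) => [|[|[|m]]] //=; rewrite nth_nil.
suff -> : coord (offset true) j = true by [].
by case: j => j /= jn; do 46 (case: j jn => [|j] jn //).
Qed.

Lemma coord_pack n s j : size s = 3 * n -> coord (pack n s) j = nth false s j.
Proof.
elim: n s j => [|n IH] s j e.
  by rewrite (size0nil e) /coord /= !nth_nil; case: (_ %% _) => [|[|[|m]]] //=; rewrite nth_nil.
case: s e => [|a [|b [|c s]]] e; try by move: e; rewrite mulnS.
have s3 : size s = 3 * n by move: e => /=; lia.
move: e => _; case: (ltnP j 3) => [|j3].
  by case: j => [|[|[|j]]] //; case: a; case: b; case: c.
by rewrite -(subnK j3) coordS IH // addn3.
Qed.

Lemma size_pack n s : size s = 3 * n -> size (pack n s) = n.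
Proof.
elim: n s => [|n IH] s e; first by rewrite (size0nil e).
case: s e => [|a [|b [|c s]]] e; try by move: e; rewrite mulnS.
by rewrite /= IH //; move: e => /=; lia.
Qed.

(** * Generators made of circulants *)

Section Gens.
Variables (a b : seq bool).

Definition entry (i j : nat) : bool :=
  if j < 23 then nth false a ((j + (23 - i)) %% 23) else nth false b ((j - 23 + (23 - i)) %% 23).

Lemma size_gens : size (gens a b) = 23. Proof. by rewrite size_mkseq. Qed.

Lemma size_gens_row i : size (rotate a i ++ rotate b i ++ [:: false; false]) = 3 * 16.
Proof. by rewrite !size_cat !size_mkseq. Qed.

Lemma coord_gens i j : i < 23 -> j < 46 -> coord (nth [::] (gens a b) i) j = entry i j.
Proof.
move=> i23 j46; rewrite nth_mkseq // coord_pack ?size_gens_row // nth_cat size_mkseq /entry.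
case: ifP => j23; first by rewrite nth_mkseq.
by rewrite nth_cat size_mkseq ifT ?nth_mkseq //; lia.
Qed.

Lemma good_gens : all good (gens a b).
Proof.
apply/allP => _ /mapP[i _ ->]; rewrite /good /is_word size_pack ?size_gens_row // eqxx.
by rewrite !coord_pack ?size_gens_row // !nth_cat !size_mkseq.
Qed.
End Gens.

(** An entry of a circulant depends only on column minus row modulo 23; here the row and the columns
    of both blocks are moved by the same [s]. *)
Lemma entry_shift a b s i j : s < 23 -> i < 23 -> j < 46 ->
  entry a b ((i + s) %% 23) (if j < 23 then (j + s) %% 23 else 23 + (j - 23 + s) %% 23) = entry a b i j.
Proof.
move=> s23 i23 j46; rewrite /entry; case: (ltnP j 23) => j23.
  by rewrite ltn_pmod //; congr nth; lia.
by rewrite ltnNge leq_addr /= addKn; congr nth; lia.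
Qed.

(** Transposing a 2 by 2 block matrix transposes each circulant and exchanges the blocks [b] and
    [c]. *)
Lemma entry_flip a b c d i j : i < 46 -> j < 46 ->
  (if i < 23 then entry (flip a) (flip c) i j else entry (flip b) (flip d) (i - 23) j) =
  (if j < 23 then entry a b j i else entry c d (j - 23) i).
Proof.
by move=> i46 j46; rewrite /entry; case: (ltnP i 23) => i23; case: (ltnP j 23) => j23;
  rewrite nth_mkseq ?ltn_pmod //; congr nth; lia.
Qed.

Lemma shift_subproof (s : 'I_23) (j : 'I_46) :
  (if j < 23 then (j + s) %% 23 else 23 + (j - 23 + s) %% 23) < 46.
Proof. by case: ifP => _; lia. Qed.
Definition shift (s : 'I_23) (j : 'I_46) : 'I_46 := Ordinal (shift_subproof s j).

Lemma shift_inj s : injective (shift s).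
Proof.
move=> i j /(congr1 val) /=; case: s i j => s /= hs [i hi] [j hj] /= e; apply: val_inj => /=.
by move: e; do 2 case: ifP => ?; lia.
Qed.

Definition gvec (G : seq word) (i : 'I_23) : 'rV['F_2]_46 := wvec (nth [::] G i).

Lemma gvec_shift a b s i j : (gvec (gens a b) (i + s) 0 (shift s j) = gvec (gens a b) i 0 j)%R.
Proof. by rewrite !mxE !coord_gens ?ltn_ord // -(@entry_shift a b s i j). Qed.

Lemma offset_shift e s j : (offset_vec e 0 (shift s j) = offset_vec e 0 j)%R.
Proof. by case: e; rewrite !mxE. Qed.

Lemma wsum_xor a b t : wsum (wxor a b) t = wxor a (wsum b t).
Proof. by elim: t b => //= x t IH b; rewrite -wxorA IH. Qed.

Lemma wxorw0 x : is_word x -> wxor x wzero = x.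
Proof. by move=> /eqP s; rewrite wxorC wxor0 // s. Qed.

Lemma wsum0 a t : is_word a -> wsum a t = wxor a (wsum wzero t).
Proof. by move=> wa; rewrite -wsum_xor wxorw0. Qed.

Lemma good_wsum a t : good a -> all good t -> good (wsum a t).
Proof. by elim: t a => //= x t IH a ga /andP[gx gt]; apply: IH; rewrite ?good_xor. Qed.

Lemma wvec_wsum a t : good a -> all good t -> wvec (wsum a t) = (wvec a + \sum_(x <- t) wvec x)%R.
Proof.
elim: t a => [|x t IH] a ga /=; first by rewrite big_nil addr0.
move=> /andP[gx gt]; rewrite IH ?good_xor // big_cons addrA wvec_xor //.
by rewrite (eqP (good_word ga)) (eqP (good_word gx)).
Qed.

Lemma wvec0 : wvec wzero = 0%R. Proof. exact: (wvec_offset false). Qed.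

Lemma mem_subs_sub (T : eqType) k (s t : seq T) : t \in subs k s -> {subset t <= s}.
Proof.
elim: s k t => [|x s IH] [|k] t //=; rewrite ?inE //; try by move=> /eqP ->.
rewrite mem_cat => /orP[/mapP[u /IH us ->] y|/IH ts y /ts]; rewrite !inE.
  by case/predU1P => [->|/us ->]; rewrite ?eqxx ?orbT.
by move=> ->; rewrite orbT.
Qed.

Lemma good_sums k L : all good L -> all good (sums k L).
Proof.
move=> gL; rewrite /sums sums_fromE cats0; apply/allP => _ /mapP[t /mem_subs_sub tL ->].
by apply: good_wsum => //; apply/allP => x /tL /(allP gL).
Qed.

(** * Lists of row sums as families of subsets of Z/23 *)

Section List.
Variable G : seq word.
Hypotheses (G_size : size G = 23) (G_good : all good G).

Lemma gens_enum : G = [seq nth [::] G (val i) | i <- enum 'I_23].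
Proof. by rewrite -[in LHS](mkseq_nth [::] G) G_size /mkseq -val_enum_ord -map_comp. Qed.

Lemma wvec_wsum_index t : wvec (wsum wzero [seq nth [::] G (val i) | i <- t]) = (\sum_(i <- t) gvec G i)%R.
Proof.
rewrite wvec_wsum ?wvec0 ?add0r ?big_map //.
by apply/allP => _ /mapP[i _ ->]; apply: (allP G_good); rewrite mem_nth // G_size ltn_ord.
Qed.

Lemma uniq_big_set (V : Type) (idx : V) (op : Monoid.com_law idx) k t (f : 'I_23 -> V) :
  t \in subs k (enum 'I_23) ->
  \big[op/idx]_(i in [set x in t]) f i = \big[op/idx]_(i <- t) f i.
Proof.
rewrite mem_subs ?enum_uniq // => /andP[/subseq_uniq /(_ (enum_uniq _)) ut _].
by rewrite big_uniq //; apply: eq_bigl => i; rewrite inE.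
Qed.

Lemma sum_sums k (h : 'rV['F_2]_46 -> nat) :
  \sum_(x <- sums k G) h (wvec x) = \sum_(A : {set 'I_23} | #|A| == k) h (\sum_(i in A) gvec G i)%R.
Proof.
rewrite sum_subs /sums sums_fromE cats0 [in LHS]gens_enum subs_map !big_map.
by apply: eq_big_seq => t ht; rewrite wvec_wsum_index (uniq_big_set _ _ ht).
Qed.

Lemma canonical_sumsE k : k < 6 -> canonical_sums k G =
  [seq wsum wzero [seq nth [::] G (val i) | i <- t]
  | t <- subs k (enum 'I_23) & 23 %| \sum_(i <- t) (val i)].
Proof.
move=> k6; rewrite /canonical_sums (nth_map 0) ?size_iota // nth_iota // add0n /canonical_tree -[X in subset_tree _ _ X]G_size.
rewrite tree_sums_fromE cats0 G_size -val_enum_ord subs_map filter_map -map_comp.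
rewrite (eq_in_filter (a2 := fun t : seq 'I_23 => 23 %| \sum_(i <- t) (val i))).
  by apply: eq_map => t /=; rewrite -map_comp.
move=> t /size_subs st /=; rewrite sumnE big_map nth_mkseq //.
rewrite (@leq_ltn_trans (size t * 22)) //; last by rewrite st; lia.
by elim: t {st} => [|i t IH] /=; rewrite ?big_nil // big_cons mulSn leq_add // -ltnS.
Qed.

Lemma sum_canonical k (h : 'rV['F_2]_46 -> nat) : k < 6 ->
  \sum_(x <- canonical_sums k G) h (wvec x) =
  \sum_(A : {set 'I_23} | (#|A| == k) && (23 %| \sum_(i in A) (val i))) h (\sum_(i in A) gvec G i)%R.
Proof.
move=> k6; rewrite canonical_sumsE // big_map big_filter big_mkcondr sum_subs big_mkcond.
apply: eq_big_seq => t ht; rewrite wvec_wsum_index (uniq_big_set _ _ ht).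
by rewrite (uniq_big_set _ _ ht).
Qed.

Lemma good_canonical k : k < 6 -> all good (canonical_sums k G).
Proof.
move=> k6; rewrite canonical_sumsE //; apply/allP => _ /mapP[t _ ->].
apply: good_wsum => //; apply/allP => _ /mapP[i _ ->].
by apply: (allP G_good); rewrite mem_nth // G_size ltn_ord.
Qed.
End List.

Lemma good_foldr_sums i L X : all good L -> all good X -> all good (foldr (fun x => sums_from i L x) [::] X).
Proof.
move=> gL; elim: X => //= x X IH /andP[gx /IH gX]; rewrite sums_fromE all_cat gX andbT.
by apply/allP => _ /mapP[t /mem_subs_sub tL ->]; apply: good_wsum => //; apply/allP => y /tL /(allP gL).
Qed.

(** Splitting the rows into two parts turns the sums of [b] rows into pairs of partial sums; one of
    the two is absorbed into the words of [X]. *)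
Lemma pair_count_halves e b X L1 L2 r : all good X -> all good L1 -> all good L2 ->
  \sum_(i <- iota 0 b.+1)
    pair_count e (foldr (fun x => sums_from i L1 x) [::] X) (sums (b - i) L2) r =
  pair_count e X (sums b (L1 ++ L2)) r.
Proof.
move=> gX g1 g2; rewrite /pair_count.
have fE i (h : word -> nat) : \sum_(x <- foldr (fun x => sums_from i L1 x) [::] X) h x =
    \sum_(x0 <- X) \sum_(t <- subs i L1) h (wsum x0 t).
  by elim: (X) => [|x Y IH] /=; rewrite ?big_nil // sums_fromE big_cat big_map IH big_cons.
under eq_bigr do rewrite fE.
rewrite exchange_big; apply: eq_big_seq => x xX /=.
have countE L k y : count (fun z => wwt (wxor y z) == r) (sums k L) =
    \sum_(t <- subs k L) (wwt (wxor y (wsum wzero t)) == r).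
  rewrite /sums sums_fromE cats0 count_map -sum1_count big_mkcond.
  by apply: eq_bigr => t _ /=; case: (_ == r).
rewrite countE sum_subs_cat.
apply: eq_bigr => i _; apply: eq_bigr => t1 _; rewrite countE.
have wx := good_word (allP gX _ xX).
apply: eq_bigr => t2 _; congr (nat_of_bool (wwt _ == r)).
rewrite -!wxorA; congr wxor.
have e12 : wsum wzero (t1 ++ t2) = wsum (wsum wzero t1) t2 by apply: foldl_cat.
have wz : wsum wzero t1 = wxor (wsum wzero t1) wzero.
  by rewrite wxorC wxor0 //; elim: (t1) (wzero) (erefl : size wzero <= 16) => //= y t IH z sz;
     rewrite IH // size_wxor geq_min sz.
have -> : wsum wzero (t1 ++ t2) = wxor (wsum wzero t1) (wsum wzero t2) by rewrite e12 {1}wz wsum_xor.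
by rewrite (wsum0 _ wx) wxorA.
Qed.

(** * Translation classes of subsets of Z/23 *)

Definition residue (A : {set 'I_23}) : 'I_23 := (\sum_(i in A) i)%R.

Lemma residue_eq0 A : (residue A == 0%R) = (23 %| \sum_(i in A) (val i)).
Proof.
rewrite /dvdn -val_eqE /=; congr (_ == 0).
rewrite /residue; elim/big_rec2: _ => [|i m n _ IH] //=.
by rewrite IH modnDmr.
Qed.

Definition translate (s : 'I_23) (A : {set 'I_23}) : {set 'I_23} := [set (i + s)%R | i in A].

Lemma translate_sum s A (V : nmodType) (f : 'I_23 -> V) :
  (\sum_(i in translate s A) f i = \sum_(i in A) f (i + s))%R.
Proof. by rewrite big_imset //= => i j _ _; apply: addIr. Qed.

Lemma card_translate s A : #|translate s A| = #|A|.
Proof. by rewrite card_imset //; apply: addIr. Qed.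

Lemma residue_translate s A : residue (translate s A) = (residue A + s *+ #|A|)%R.
Proof. by rewrite /residue translate_sum big_split sumr_const. Qed.

Lemma translateK s : cancel (translate s) (translate (- s)%R).
Proof.
move=> A; rewrite /translate -imset_comp -[RHS]imset_id; apply: eq_imset => i /=.
by rewrite addrK.
Qed.

Lemma translate_bij s : bijective (translate s).
Proof. by exists (translate (- s)%R); [|rewrite -{2}[s]opprK]; apply: translateK. Qed.

(* 23 is prime, so translating a set of k < 23 elements moves its residue arbitrarily *)
Lemma residue_solve k (rho : 'I_23) : 0 < k < 23 -> exists s : 'I_23, (s *+ k = rho)%R.
Proof.
move=> k23; have [m mk] : exists m, (m * k) %% 23 = 1.
  have : coprime k 23 by rewrite coprime_sym prime_coprime // gtnNdvd; lia.
  move=> /coprimeP; case=> [|[u v] /= uv]; first lia.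
  by exists u; move: uv; lia.
exists (rho *+ m)%R; rewrite -mulrnA; apply: val_inj.
by rewrite Zp_mulrn /= -modnMmr mk muln1 modn_small.
Qed.

(** The sets [A2] are sorted by residue. A simultaneous translation of both sets by s, where b times
    s is the residue, identifies each of the 23 classes with the class of residue 0. *)
Lemma canonical_representatives (F : {set 'I_23} -> {set 'I_23} -> nat) a b : 0 < b < 23 ->
  (forall s A1 A2, F (translate s A1) (translate s A2) = F A1 A2) ->
  \sum_(A1 : {set 'I_23} | #|A1| == a) \sum_(A2 : {set 'I_23} | #|A2| == b) F A1 A2 =
  23 * \sum_(A1 : {set 'I_23} | #|A1| == a) \sum_(A2 : {set 'I_23} | (#|A2| == b) && (23 %| \sum_(i in A2) (val i))) F A1 A2.
Proof.
move=> b23 F_inv.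
have -> : \sum_(A1 : {set 'I_23} | #|A1| == a) \sum_(A2 : {set 'I_23} | #|A2| == b) F A1 A2 =
   \sum_(rho : 'I_23) \sum_(A1 : {set 'I_23} | #|A1| == a) \sum_(A2 : {set 'I_23} | (#|A2| == b) && (residue A2 == rho)) F A1 A2.
  rewrite [RHS]exchange_big; apply: eq_bigr => A1 _.
  by rewrite (partition_big residue xpredT).
set S := (X in _ = 23 * X).
have -> : 23 * S = \sum_(rho : 'I_23) S by rewrite sum_nat_const card_ord.
apply: eq_bigr => rho _; rewrite {}/S.
have [s s_rho] := residue_solve rho b23.
rewrite (reindex (translate s)) /=; last exact/onW_bij/translate_bij.
apply: eq_big => [A1|A1 _]; first by rewrite card_translate.
rewrite (reindex (translate s)) /=; last exact/onW_bij/translate_bij.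
apply: eq_big => [A2|A2 _]; last exact: F_inv.
rewrite card_translate residue_translate -residue_eq0; case: eqP => //= ->.
by rewrite s_rho -[X in _ == X]add0r (inj_eq (addIr rho)).
Qed.

(** * Words counted by the number of rows taken from each block *)

Section TypeCount.
Variables (a b c d : seq bool) (e : bool).
Let G1 := gens a b.
Let G2 := gens c d.

Definition set_vec (G1 G2 : seq word) (A1 A2 : {set 'I_23}) : 'rV['F_2]_46 :=
  (\sum_(i in A1) gvec G1 i + \sum_(i in A2) gvec G2 i)%R.

Definition type_count (G1 G2 : seq word) k1 k2 r : nat :=
  \sum_(A1 : {set 'I_23} | #|A1| == k1) \sum_(A2 : {set 'I_23} | #|A2| == k2)
     (hamming_weight (set_vec G1 G2 A1 A2 + offset_vec e)%R == r).

Lemma type_countC H1 H2 k1 k2 r : type_count H1 H2 k1 k2 r = type_count H2 H1 k2 k1 r.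
Proof.
by rewrite /type_count exchange_big; apply: eq_bigr => A2 _; apply: eq_bigr => A1 _;
  rewrite /set_vec [(\sum_(i in A1) _ + _)%R]addrC.
Qed.

(** Translating both index sets permutes the coordinates cyclically in each block, and the offset
    vector is constant. *)
Lemma weight_translate s A1 A2 :
  hamming_weight (set_vec G1 G2 (translate s A1) (translate s A2) + offset_vec e)%R =
  hamming_weight (set_vec G1 G2 A1 A2 + offset_vec e)%R.
Proof.
rewrite !hamming_weight_sum (reindex_inj (@shift_inj s)) /=; apply: eq_bigr => j _.
congr (nat_of_bool (_ != _)); rewrite /set_vec !mxE offset_shift; congr (_ + _)%R.
by congr (_ + _)%R; rewrite !summxE translate_sum; apply: eq_bigr => i _; rewrite gvec_shift.
Qed.

Lemma pair_count_vec X Y r : all good X -> all good Y ->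
  pair_count e X Y r =
  \sum_(x <- X) \sum_(y <- Y) (hamming_weight (wvec x + wvec y + offset_vec e)%R == r).
Proof.
move=> gX gY; rewrite /pair_count; apply: eq_big_seq => x /(allP gX) gx.
rewrite -sum1_count big_mkcond; apply: eq_big_seq => y /(allP gY) gy.
have sz z : good z -> size z = 16 by move=> /good_word /eqP.
rewrite wwt_weight ?good_xor ?good_offset // !wvec_xor ?sz ?good_xor ?good_offset // wvec_offset.
by rewrite -addrA addrC; case: (_ == r).
Qed.

(** For [k2] at most 5 the representatives are chosen on the [k2] rows. Otherwise [k1] is at most 1
    and they are chosen on the other block. *)
Lemma type_hits_le_count tc ts k1 k2 r : k1 <= k2 -> 0 < k2 -> k1 + k2 <= 7 -> r <= component e (tc, ts) ->
  multiplicity k1 k2 * count (eqn r) (component e (type_hits_le tc ts G1 G2 k1 k2)) = type_count G1 G2 k1 k2 r.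
Proof.
move=> k12 k2_gt0 k7 rt; have [s1 s2] : size G1 = 23 /\ size G2 = 23 by rewrite !size_gens.
have [g1 g2] : all good G1 /\ all good G2 by split; apply: good_gens.
have w_of_g L : all good L -> all is_word L := @sub_all _ _ _ good_word L.
have F_inv s A1 A2 : nat_of_bool (hamming_weight (set_vec G1 G2 (translate s A1) (translate s A2) + offset_vec e)%R == r)
   = (hamming_weight (set_vec G1 G2 A1 A2 + offset_vec e)%R == r) by rewrite weight_translate.
have k1_6 : k1 < 6 by lia.
rewrite /type_hits_le; case: ifP => k2_5; last first.
  have k2_6 : k2 < 6 by lia.
  have gc := good_canonical s2 g2 k2_6.
  have -> : count (eqn r) (component e (join tc ts (sums k1 G1) (canonical_sums k2 G2) ([::], [::]))) =
      pair_count e (sums k1 G1) (canonical_sums k2 G2) r.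
    by rewrite join_count ?w_of_g ?good_sums //; case: (e); rewrite addn0.
  rewrite pair_count_vec ?good_sums //.
  have -> : multiplicity k1 k2 = 23 by rewrite /multiplicity (maxn_idPr k12) k2_5 andbF.
  rewrite /type_count (canonical_representatives k1 (b := k2) _ F_inv); last lia.
  congr (_ * _).
  rewrite -(sum_sums s1 g1 k1 (fun v => \sum_(A2 : {set 'I_23} | (#|A2| == k2) && (23 %| \sum_(i in A2) (val i)))
     (hamming_weight (v + \sum_(i in A2) gvec G2 i + offset_vec e)%R == r))).
  apply: eq_bigr => x _.
  by rewrite -(sum_canonical s2 g2 (fun v => hamming_weight (wvec x + v + offset_vec e)%R == r)).
have k1_1 : k1 <= 1 by lia.
have gc := good_canonical s1 g1 k1_6.
have gt : all good (take 11 G2) by apply/allP => x /mem_take /(allP g2).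
have gd : all good (drop 11 G2) by apply/allP => x /mem_drop /(allP g2).
have -> : count (eqn r) (component e (foldr (fun i => join tc ts
        (foldr (fun x0 => sums_from i (take 11 G2) x0) [::] (canonical_sums k1 G1))
        (sums (k2 - i) (drop 11 G2))) ([::], [::]) (iota 0 k2.+1))) =
   pair_count e (canonical_sums k1 G1) (sums k2 (take 11 G2 ++ drop 11 G2)) r.
  have fold J g s : (forall i acc, count (eqn r) (component e (J i acc)) = g i + count (eqn r) (component e acc)) ->
      count (eqn r) (component e (foldr J ([::], [::]) s)) = \sum_(i <- s) g i :> nat.
    move=> JE; elim: s => [|i s IH] /=; first by rewrite big_nil; case: (e).
    by rewrite JE IH big_cons.
  rewrite -pair_count_halves //; apply: fold => i acc.
  by rewrite join_count ?w_of_g ?good_foldr_sums ?good_sums.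
rewrite cat_take_drop pair_count_vec ?good_sums //.
have -> : \sum_(x <- canonical_sums k1 G1) \sum_(y <- sums k2 G2) (hamming_weight (wvec x + wvec y + offset_vec e)%R == r) =
  \sum_(A1 : {set 'I_23} | (#|A1| == k1) && (23 %| \sum_(i in A1) (val i)))
     \sum_(A2 : {set 'I_23} | #|A2| == k2) (hamming_weight (set_vec G1 G2 A1 A2 + offset_vec e)%R == r).
  rewrite (sum_canonical s1 g1 (fun v => \sum_(y <- sums k2 G2) (hamming_weight (v + wvec y + offset_vec e)%R == r))) //.
  apply: eq_bigr => A1 _.
  by rewrite (sum_sums s2 g2 k2 (fun v => hamming_weight (\sum_(i in A1) gvec G1 i + v + offset_vec e)%R == r)).
(* For [k1] = 0 the empty set is the only choice and has residue 0, so the canonical sum is already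
   the full one. *)
case: k1 k1_1 {k12 k7 k1_6 gc} => [|[|//]] _.
  rewrite /multiplicity min0n max0n k2_5 mul1n /type_count.
  apply: eq_bigl => A1; case: eqP => //= /eqP; rewrite cards_eq0 => /eqP ->.
  by rewrite big_set0.
rewrite /multiplicity (minn_idPl k2_gt0) /= /type_count exchange_big [RHS]exchange_big /=.
(* For [k1] = 1 the sums have been exchanged so that the single row is the set normalised by
   translation. *)
rewrite (canonical_representatives k2 (b := 1) (F := fun A2 A1 => (hamming_weight (set_vec G1 G2 A1 A2 + offset_vec e)%R == r) : nat)) //.
Qed.
End TypeCount.

Lemma type_hits_count a b c d e tc ts k1 k2 r : 0 < k1 + k2 <= 7 -> r <= component e (tc, ts) ->
  multiplicity k1 k2 * count (eqn r) (component e (type_hits tc ts (gens a b) (gens c d) k1 k2)) =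
  type_count e (gens a b) (gens c d) k1 k2 r.
Proof.
move=> k7 rt; rewrite /type_hits; case: leqP => k12; first by rewrite type_hits_le_count //; lia.
by rewrite type_countC -(@type_hits_le_count _ _ _ _ _ tc ts) /multiplicity ?[minn k2 _]minnC ?[maxn k2 _]maxnC //; lia.
Qed.

(** * Four-circulant codes *)

Local Open Scope ring_scope.

Definition overlap n (x y : 'rV['F_2]_n) : nat := (\sum_i ((x 0%R i != 0%R) && (y 0%R i != 0%R)))%N.

Lemma weightD n (x y : 'rV['F_2]_n) :
  (hamming_weight (x + y)%R + 2 * overlap x y = hamming_weight x + hamming_weight y)%N.
Proof.
rewrite !hamming_weight_sum /overlap big_distrr -!big_split /=; apply: eq_bigr => i _.
by rewrite mxE; case: (F2P (x 0 i)) => ->; case: (F2P (y 0 i)) => ->.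
Qed.

Lemma inner_product_overlap n (x y : 'rV['F_2]_n) : inner_product x y = (overlap x y)%:R.
Proof.
rewrite /inner_product /overlap natr_sum; apply: eq_bigr => i _.
by case: (F2P (x 0 i)) => ->; case: (F2P (y 0 i)) => ->; apply: val_inj.
Qed.

Lemma natr_F2_odd m : (m%:R : 'F_2) = (odd m)%:R.
Proof.
rewrite -[m in LHS]odd_double_half natrD -muln2 natrM (_ : 2%:R = 0 :> 'F_2) ?mulr0 ?addr0 //.
exact: val_inj.
Qed.

Lemma inner_product_mx n (x y : 'rV['F_2]_n) : inner_product x y = (x *m y^T) 0 0.
Proof. by rewrite mxE; apply: eq_bigr => i _; rewrite mxE. Qed.

Lemma hamming_weight_eq0 n (x : 'rV['F_2]_n) : (hamming_weight x == 0%N) = (x == 0).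
Proof.
apply/idP/eqP => [/eqP|->]; last by rewrite hamming_weight0.
move=> /cards0_eq x0; apply/rowP => i; rewrite mxE; apply/eqP.
by have := in_set0 i; rewrite -x0 inE => /negbFE.
Qed.

Lemma hamming_weight_row_mx m n (x : 'rV['F_2]_m) (y : 'rV['F_2]_n) :
  hamming_weight (row_mx x y) = (hamming_weight x + hamming_weight y)%N.
Proof.
rewrite !hamming_weight_sum big_split_ord /=.
by congr (_ + _)%N; apply: eq_bigr => i _; rewrite ?row_mxEl ?row_mxEr.
Qed.

Lemma hamming_weight_ones n : hamming_weight (const_mx 1 : 'rV['F_2]_n) = n.
Proof. by have := hamming_weight_compl (0 : 'rV['F_2]_n); rewrite addr0 hamming_weight0 subn0. Qed.

Definition quad_circulant (a b c d : seq bool) : 'M['F_2]_(23 + 23, 46) :=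
  \matrix_(i, j) (if (i < 23)%N then entry a b i j else entry c d (i - 23) j)%:R.

Section QuadCirculant.
Variables a b c d : seq bool.
Let M := quad_circulant a b c d.
Let G1 := gens a b.
Let G2 := gens c d.

Lemma row_quad i : row i M = wvec (nth [::] (G1 ++ G2) i).
Proof.
apply/rowP => j; rewrite !mxE nth_cat size_gens; case: ifP => i23; rewrite coord_gens //.
by have := ltn_ord i; lia.
Qed.

Definition indicator (A : {set 'I_23} * {set 'I_23}) : 'rV['F_2]_(23 + 23) :=
  row_mx (\row_i (i \in A.1)%:R) (\row_i (i \in A.2)%:R).

Lemma indicator_weight A : hamming_weight (indicator A) = (#|A.1| + #|A.2|)%N.
Proof.
have H (B : {set 'I_23}) : hamming_weight (\row_i (i \in B)%:R : 'rV['F_2]_23) = #|B|.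
  rewrite hamming_weight_sum -sum1_card [RHS]big_mkcond; apply: eq_bigr => i _.
  by rewrite mxE natrb_eq0; case: (i \in B).
by rewrite hamming_weight_row_mx !H.
Qed.

Lemma indicator_mul A : indicator A *m M = set_vec G1 G2 A.1 A.2.
Proof.
apply/rowP => j; rewrite !mxE big_split_ord /=; congr (_ + _); rewrite summxE [RHS]big_mkcond;
  apply: eq_bigr => i _; rewrite ?row_mxEl ?row_mxEr !mxE /=.
  by rewrite ltn_ord coord_gens //; case: (i \in _); rewrite ?mul1r ?mul0r.
by rewrite addKn coord_gens //; case: (i \in _); rewrite ?mul1r ?mul0r.
Qed.

Lemma indicator_bij : bijective indicator.
Proof.
exists (fun v : 'rV['F_2]_(23 + 23) => ([set i | v 0 (lshift 23 i) != 0], [set i | v 0 (rshift 23 i) != 0])) => [[A1 A2]|v].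
  by congr pair; apply/setP => i; rewrite inE ?row_mxEl ?row_mxEr mxE natrb_eq0.
rewrite -[v in RHS]hsubmxK /indicator; congr row_mx; apply/rowP => i; rewrite !mxE inE;
  by [case: (F2P (v 0 (lshift 23 i))) => -> | case: (F2P (v 0 (rshift 23 i))) => ->].
Qed.

(** Words of the code or its shadow, counted by the weights of their two halves. *)
Definition weight_pairs (e : bool) (l r : nat) : nat :=
  #|[set v : 'rV['F_2]_(23 + 23) | (hamming_weight v == l) && (hamming_weight (v *m M + offset_vec e) == r)]|.

Lemma weight_pairs_types e l r :
  weight_pairs e l r = (\sum_(k <- iota 0 l.+1) type_count e G1 G2 k (l - k) r)%N.
Proof.
rewrite /weight_pairs -sum1dep_card big_mkcond (reindex indicator) /=; last exact/onW_bij/indicator_bij.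
rewrite (eq_bigr (fun A : {set 'I_23} * {set 'I_23} => (\sum_(k <- iota 0 l.+1) ((#|A.1| == k) && (#|A.2| == l - k) &&
   (hamming_weight (set_vec G1 G2 A.1 A.2 + offset_vec e)%R == r)))%N)); last first.
  move=> A _; rewrite indicator_weight indicator_mul.
  case: (_ == r); last by rewrite andbF big1 // => k _; rewrite andbF.
  rewrite andbT; case: eqP => [<-|ne].
    rewrite (bigD1_seq #|A.1|) ?iota_uniq ?mem_iota //=; last lia.
    rewrite eqxx addKn eqxx big1 // => k /negbTE; rewrite eq_sym => ->; by [].
  rewrite big_seq big1 // => k; rewrite mem_iota => kl; rewrite andbT.
  by case: andP => // -[/eqP k1 /eqP k2]; case: ne; lia.
rewrite exchange_big /=; apply: eq_bigr => k _; rewrite /type_count.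
rewrite pair_big_dep /= [RHS]big_mkcond; apply: eq_bigr => A _ /=.
by case: (_ && (_ == (l - k)%N)).
Qed.

Definition row_total (w : nat) (e : bool) (row : seq (nat * (seq nat * seq nat))) : nat :=
  (\sum_(x <- row) x.1 * count (eqn w) (component e x.2))%N.

Lemma run_row e l tc ts r : (0 < l <= 7)%N -> (r <= component e (tc, ts))%N ->
  row_total r e [seq (multiplicity k (l - k), type_hits tc ts G1 G2 k (l - k)) | k <- iota 0 l.+1]
  = weight_pairs e l r.
Proof.
move=> l7 rt; rewrite /row_total big_map weight_pairs_types; apply: eq_big_seq => k.
by rewrite mem_iota => kl /=; rewrite type_hits_count //; lia.
Qed.

Lemma no_code_wordP B l tc ts r : no_code_word (run B G1 G2) -> (l, tc, ts) \in B ->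
  (0 < l <= 7)%N -> (r <= tc)%N -> weight_pairs false l r = 0%N.
Proof.
move=> /allP H lB l7 rt; rewrite -(run_row (e := false) l7 (tc := tc) (ts := ts)) //.
have /allP/= := H _ (map_f _ lB) => /= {}H.
rewrite /row_total big_seq big1 // => x /H; rewrite /nilp => /nilP /= ->.
by rewrite muln0.
Qed.

Lemma shadow_countE B w m : all (fun x => (0 < x.1.1 <= 7)%N && (w - x.1.1 <= x.2)%N) B ->
  shadow_count (run B G1 G2) w m =
  (\sum_(x <- B) if m <= w - x.1.1 then weight_pairs true x.1.1 (w - x.1.1) else 0)%N.
Proof.
have foldE r s n : foldr (fun x n => x.1 * count (eqn r) x.2.2 + n)%N n s = (row_total r true s + n)%N.
  by rewrite /row_total; elim: s => [|x s IHs]; rewrite ?big_nil // big_cons -addnA -IHs.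
elim: B => [|[[l tc] ts] B IH]; first by rewrite big_nil.
rewrite [all _ _]/= => /andP[/andP[l7 wt] /IH {}IH].
rewrite big_cons -IH -(run_row (e := true) l7 (tc := tc) (ts := ts)) // {IH}.
rewrite [shadow_count (run (_ :: _) _ _) _ _]/shadow_count [run _ _ _]/run map_cons.
set row := [seq _ | k <- iota 0 l.+1].
transitivity (if (m <= w - l)%N then foldr (fun x n => x.1 * count (eqn (w - l)) x.2.2 + n)%N
   (shadow_count (run B G1 G2) w m) row else shadow_count (run B G1 G2) w m); first by [].
by rewrite foldE; case: ifP.
Qed.
End QuadCirculant.

Lemma quad_circulant_tr a b c d :
  (quad_circulant a b c d)^T = quad_circulant (flip a) (flip c) (flip b) (flip d).
Proof. by apply/matrixP => i j; rewrite !mxE (@entry_flip a b c d i j). Qed.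

Lemma inner_product_row_mx m n (x1 y1 : 'rV['F_2]_m) (x2 y2 : 'rV['F_2]_n) :
  inner_product (row_mx x1 x2) (row_mx y1 y2) = inner_product x1 y1 + inner_product x2 y2.
Proof.
rewrite /inner_product big_split_ord /=.
by congr (_ + _); apply: eq_bigr => i _; rewrite ?row_mxEl ?row_mxEr.
Qed.

(** * Systematic codes of orthogonal matrices *)

Section UnitaryCode.
Variable M : 'M['F_2]_46.
Hypothesis M_unitary : M *m M^T = 1%:M.

Definition word_map : 'Hom('rV['F_2]_46, 'rV['F_2]_92) := linfun (mulmxr (row_mx 1%:M M : 'M_(46, 46 + 46))).
Definition systematic_code : binary_code 92 := limg word_map.

Lemma word_mapE v : word_map v = row_mx v (v *m M) :> 'rV_(46 + 46).
Proof.
have -> : row_mx v (v *m M) = v *m row_mx 1%:M M by rewrite mul_mx_row mulmx1.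
by rewrite lfunE.
Qed.

Lemma systematic_codeP (x : 'rV['F_2]_(46 + 46)) :
  reflect (exists v, x = row_mx v (v *m M)) (x \in systematic_code).
Proof.
apply: (iffP memv_imgP) => [[v _ ->]|[v ->]]; first by exists v; rewrite word_mapE.
by exists v; [exact: memvf | rewrite word_mapE].
Qed.

Lemma word_map_inj : injective word_map.
Proof. by move=> v w; rewrite !word_mapE => e; have [] := @eq_row_mx _ 1 46 46 _ _ _ _ e. Qed.

Lemma dim_systematic_code : \dim systematic_code = 46%N.
Proof.
rewrite limg_dim_eq; first by rewrite dimvf /dim /= mul1n.
by rewrite capfv; apply/eqP/lker0P => v w; apply: word_map_inj.
Qed.

Lemma card_systematic_code : #|systematic_code|%:R = 2 ^+ 46 :> Z.
Proof.
have -> : #|systematic_code| = #|[set word_map v | v in {: 'rV['F_2]_46}]|.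
  apply: eq_card => x; apply/systematic_codeP/imsetP => [[v ->]|[v _ ->]]; exists v => //;
  by rewrite word_mapE.
by rewrite card_imset ?card_mx ?card_Fp ?mul1n ?natrX //; apply: word_map_inj.
Qed.

Lemma tr_unitary : M^T *m M = 1%:M. Proof. exact: mulmx1C. Qed.

Lemma mul_unitary_inj (v w : 'rV['F_2]_46) : v *m M = w *m M -> v = w.
Proof. by move=> e; rewrite -[v]mulmx1 -[w]mulmx1 -M_unitary !mulmxA e. Qed.

Lemma inner_product_unitary v w : inner_product (v *m M) (w *m M) = inner_product v w.
Proof. by rewrite !inner_product_mx trmx_mul mulmxA -(mulmxA v) M_unitary mulmx1. Qed.

(** The two halves of a codeword contribute equal inner products, which cancel in characteristic
    2. *)
Lemma systematic_code_self_dual : self_dual systematic_code.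
Proof.
move=> x; rewrite inE; have := @hsubmxK _ 1 46 46 x.
move: (@lsubmx _ 1 46 46 x) (@rsubmx _ 1 46 46 x) => x1 x2 <-; apply/idP/forallP => [/systematic_codeP[v e] y|H].
  apply/implyP => /systematic_codeP[w ->]; have [-> ->] := @eq_row_mx _ 1 46 46 _ _ _ _ e.
  by rewrite (@inner_product_row_mx 46 46) inner_product_unitary -mulr2n -mulr_natl mulrC (_ : 2%:R = 0) ?mulr0 //; apply: val_inj.
apply/systematic_codeP; exists x1; congr row_mx.
(* Conversely, orthogonality to the generators gives this equation coordinate by coordinate;
   multiplying it by M yields x2 = x1 M. *)
have : x1 + x2 *m M^T = 0.
  apply/rowP => i; rewrite [RHS]mxE.
  have /implyP/(_ (introT (systematic_codeP _) (ex_intro _ (delta_mx 0 i) erefl)))/eqP := H (row_mx (delta_mx 0 i) (delta_mx 0 i *m M) : 'rV_(46 + 46)).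
  rewrite (@inner_product_row_mx 46 46) !inner_product_mx trmx_mul mulmxA -[_ *m _ *m _]/((x2 *m M^T) *m _).
  by move: (x2 *m M^T) => z; rewrite trmx_delta -!colE !mxE.
move=> /(congr1 (mulmx^~ M)); rewrite mulmxDl mul0mx -mulmxA tr_unitary mulmx1 => e.
by rewrite -[x2]add0r -(F2_addvv (x1 *m M)) -addrA e addr0.
Qed.
End UnitaryCode.

(** * Orthogonality and weights modulo 4 *)

Section Unitary.
Variables a b c d : seq bool.
Let G := gens a b ++ gens c d.
Hypothesis G_unitary : unitary_gens G.
Let M : 'M['F_2]_46 := quad_circulant a b c d.

Let size_G : size G = 46. Proof. by rewrite size_cat !size_gens. Qed.
Let good_G i : (i < 46)%N -> good (nth [::] G i).
Proof. by move=> i46; apply: (allP _ _ (mem_nth _ _)); rewrite ?size_G // all_cat !good_gens. Qed.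

Let row_M i : row i M = wvec (nth [::] G i). Proof. exact: row_quad. Qed.

Let weight_row i : (hamming_weight (row i M) %% 4 = 1)%N.
Proof.
rewrite row_M -wwt_weight ?good_G //; have /andP[/allP H _] := G_unitary.
by have := H (nth [::] G i); rewrite mem_nth ?size_G // => /(_ isT); rewrite eqnE => /eqP.
Qed.

Let weight_row2 (i k : 'I_46) : (i < k)%N -> (hamming_weight (row i M + row k M)%R %% 4 = 2)%N.
Proof.
move=> ik; have /andP[_ /(pairwiseP [::]) H] := G_unitary.
have := H i k; rewrite !inE size_G !ltn_ord => /(_ isT isT ik) /=; rewrite eqnE => /eqP.
by rewrite wwt_weight ?good_xor ?good_G // wvec_xor -?row_M // !(eqP (good_word (good_G _))).
Qed.

(** Two rows of weight 1 modulo 4 whose sum has weight 2 modulo 4 overlap in an even number of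
    places, and a row of odd weight has norm 1. *)
Lemma quad_unitary : M *m M^T = 1%:M.
Proof.
have rowE (i k : 'I_46) : (M *m M^T) i k = inner_product (row i M) (row k M).
  by rewrite mxE; apply: eq_bigr => j _; rewrite !mxE.
have off (i k : 'I_46) : (i < k)%N -> inner_product (row i M) (row k M) = 0.
  move=> ik; rewrite inner_product_overlap natr_F2_odd.
  have := weightD (row i M) (row k M); have := weight_row i; have := weight_row k; have := weight_row2 ik.
  by move=> h1 h2 h3 h4; rewrite (_ : odd _ = false) //; lia.
apply/matrixP => i k; rewrite rowE !mxE; case: (ltngtP i k) => [ik|ki|/val_inj ->].
- by rewrite off // -val_eqE (ltn_eqF ik).
- by rewrite inner_productC off // -val_eqE (gtn_eqF ki).
rewrite eqxx inner_product_overlap natr_F2_odd.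
have -> : overlap (row k M) (row k M) = hamming_weight (row k M).
  by rewrite hamming_weight_sum; apply: eq_bigr => j _; rewrite andbb.
by have := weight_row k => h; rewrite (_ : odd _ = true) //; lia.
Qed.

(** The expression is additive modulo 4: M preserves inner products, so the overlaps o of x, y and
    o' of their images have the same parity, and the correction 6o + 2o' is divisible by 4. On a
    basis vector it is 3 plus a row weight congruent to 1. *)
Lemma quad_doubly_even (v : 'rV['F_2]_46) : ((3 * hamming_weight v + hamming_weight (v *m M)%R) %% 4 = 0)%N.
Proof.
pose P (v : 'rV['F_2]_46) := ((3 * hamming_weight v + hamming_weight (v *m M)%R) %% 4 = 0)%N.
rewrite [v]row_sum_delta -/(P _); apply: (big_ind P) => [|x y Px Py|i _].
- by rewrite /P mul0mx !hamming_weight0.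
- have := weightD x y; have := weightD (x *m M) (y *m M).
  have : (overlap (x *m M) (y *m M) %% 2 = overlap x y %% 2)%N.
    rewrite !modn2; congr nat_of_bool; have := inner_product_unitary quad_unitary x y; rewrite !inner_product_overlap natr_F2_odd [RHS]natr_F2_odd.
    by case: (odd _); case: (odd _).
  move: Px Py; rewrite /P mulmxDl.
  move: (hamming_weight x) (hamming_weight y) (hamming_weight (x + y)) (hamming_weight (x *m M))
    (hamming_weight (y *m M)) (hamming_weight (x *m M + y *m M)) (overlap x y) (overlap _ _).
  lia.
case: (F2P (v 0 i)) => ->; first by rewrite scale0r /P mul0mx !hamming_weight0.
rewrite scale1r /P -rowE.
have -> : hamming_weight (delta_mx 0 i : 'rV['F_2]_46) = 1%N.
  rewrite hamming_weight_sum (bigD1 i) //= mxE !eqxx /= big1 // => j ji.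
  by rewrite mxE (negbTE ji) andbF.
by rewrite -modnDmr weight_row.
Qed.

Lemma ones_quad : (const_mx 1 : 'rV['F_2]_46) *m M^T = const_mx 1.
Proof.
apply/rowP => i; rewrite !mxE.
transitivity (inner_product (const_mx 1) (row i M)).
  by apply: eq_bigr => j _; rewrite !mxE.
have -> : inner_product (const_mx 1) (row i M) = (hamming_weight (row i M))%:R.
  rewrite hamming_weight_sum natr_sum; apply: eq_bigr => j _.
  by rewrite mxE mul1r; case: (F2P (row i M 0 j)) => ->.
by rewrite natr_F2_odd (_ : odd _ = true) //; have := weight_row i; lia.
Qed.
End Unitary.

(** * From a successful check to the small weights of code and shadow *)

Section CheckedCode.
Variables (a b c d : seq bool) (s10 s14 : nat).
Hypothesis checked : check_code (a, b, (c, d)) s10 s14.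
Let M : 'M['F_2]_46 := quad_circulant a b c d.
Let C := systematic_code M.
Let u : 'rV['F_2]_92 := (row_mx 0 (const_mx 1) : 'rV_(46 + 46)).
Let L := run left_bounds (gens a b) (gens c d).
Let R := run right_bounds (gens (flip a) (flip c)) (gens (flip b) (flip d)).

Let checkedE : [/\ unitary_gens (gens a b ++ gens c d), no_code_word L, no_code_word R &
  forall w, w \in [:: 0; 2; 4; 6; 8; 10; 12; 14]%N ->
    (shadow_count L w 0 + shadow_count R w 8 = if w == 10 then s10 else if w == 14 then s14 else 0)%N].
Proof.
move: checked; rewrite /check_code => /andP[h1 /and3P[h2 h3 /allP h4]]; split=> // w /h4.
by rewrite eqnE => /eqP.
Qed.

Let M_unitary : M *m M^T = 1%:M.
Proof. by apply: quad_unitary; case: checkedE. Qed.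
Let M_even (v : 'rV['F_2]_46) : ((3 * hamming_weight v + hamming_weight (v *m M)%R) %% 4 = 0)%N.
Proof. by apply: quad_doubly_even; case: checkedE. Qed.
Let ones_M : (const_mx 1 : 'rV['F_2]_46) *m M^T = const_mx 1.
Proof. by apply: ones_quad; case: checkedE. Qed.
Let M_tr : M^T = quad_circulant (flip a) (flip c) (flip b) (flip d).
Proof. exact: quad_circulant_tr. Qed.

Let NL e l r := weight_pairs a b c d e l r.
Let NR e l r := weight_pairs (flip a) (flip c) (flip b) (flip d) e l r.

Let NL_E e l r : NL e l r =
  #|[set v : 'rV['F_2]_46 | (hamming_weight v == l) && (hamming_weight (v *m M + offset_vec e)%R == r)]|.
Proof. by []. Qed.
Let NR_E e l r : NR e l r =
  #|[set v : 'rV['F_2]_46 | (hamming_weight v == l) && (hamming_weight (v *m M^T + offset_vec e)%R == r)]|.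
Proof. rewrite M_tr; reflexivity. Qed.

Lemma offset_tr e : offset_vec e *m M^T = offset_vec e.
Proof. by case: e; rewrite /offset_vec ?ones_M ?mul0mx. Qed.

(** Mapping v to vM plus the offset exchanges the roles of the halves; its inverse has the same form
    with the transpose of M, because the offset is fixed by M and its transpose. *)
Lemma transpose_pairs e l r : NR e r l = NL e l r.
Proof.
rewrite NR_E NL_E.
pose f (v : 'rV['F_2]_46) := v *m M + offset_vec e.
pose g (v : 'rV['F_2]_46) := v *m M^T + offset_vec e.
have fg : cancel f g.
  by move=> v; rewrite /f /g mulmxDl -mulmxA M_unitary mulmx1 offset_tr -addrA F2_addvv addr0.
have offset_M : offset_vec e *m M = offset_vec e.
  by rewrite -[in LHS]offset_tr -mulmxA (tr_unitary M_unitary) mulmx1.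
have gf : cancel g f.
  by move=> v; rewrite /f /g mulmxDl -mulmxA (tr_unitary M_unitary) mulmx1 offset_M -addrA F2_addvv addr0.
rewrite -(card_imset _ (can_inj gf)); apply: eq_card => v.
apply/imsetP/idP => [[w]|]; rewrite !inE.
  move=> /andP[/eqP wr wl] ->; rewrite -/(f _) gf wr eqxx andbT; exact: wl.
by move=> /andP[vl vr]; exists (f v); rewrite ?fg // inE -/(g _) fg vl vr.
Qed.

Let no_left l tc ts r : (l, tc, ts) \in left_bounds -> (r <= tc)%N -> NL false l r = 0%N.
Proof.
move=> lB rt; case: checkedE => _ hL _ _.
apply: (no_code_wordP hL lB) => //; move: lB; rewrite !inE.
by do ?[case/orP]; move=> /eqP[-> _ _].
Qed.

Let no_right l tc ts r : (l, tc, ts) \in right_bounds -> (r <= tc)%N -> NR false l r = 0%N.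
Proof.
move=> lB rt; case: checkedE => _ _ hR _.
apply: (no_code_wordP hR lB) => //; move: lB; rewrite !inE.
by do ?[case/orP]; move=> /eqP[-> _ _].
Qed.

Lemma code_weight (v : 'rV['F_2]_46) : v != 0 -> (16 <= hamming_weight v + hamming_weight (v *m M)%R)%N.
Proof.
move=> v0; set l := hamming_weight v; set r := hamming_weight (v *m M).
have l0 : (0 < l)%N by rewrite lt0n hamming_weight_eq0.
have r0 : (0 < r)%N.
  rewrite lt0n hamming_weight_eq0; apply: contra v0 => /eqP vM; apply/eqP.
  by apply: (mul_unitary_inj M_unitary); rewrite vM mul0mx.
have lr := M_even v; rewrite -/l -/r in lr.
have NLpos : NL false l r != 0%N.
  rewrite NL_E -lt0n; apply/card_gt0P; exists v.
  by rewrite inE addr0 !eqxx.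
rewrite leqNgt; apply: contra NLpos => small.
have [l7|l8] := leqP l 7.
  have : l \in [:: 1; 2; 3; 4; 5; 6; 7]%N by rewrite !inE; lia.
  rewrite !inE => lE; apply/eqP.
  move: lE; do ?[case/orP]; move=> /eqP lE.
  - by rewrite lE; apply: (@no_left 1 13 13) => //; lia.
  - by rewrite lE; apply: (@no_left 2 10 12) => //; lia.
  - by rewrite lE; apply: (@no_left 3 11 11) => //; lia.
  - by rewrite lE; apply: (@no_left 4 8 10) => //; lia.
  - by rewrite lE; apply: (@no_left 5 9 9) => //; lia.
  - by rewrite lE; apply: (@no_left 6 6 8) => //; lia.
  - by rewrite lE; apply: (@no_left 7 7 7) => //; lia.
(* Here the left weight is at least 8 and the total at most 15. Congruence modulo 4 excludes right
   weights 6 and 7. *)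
rewrite -transpose_pairs; have : r \in [:: 1; 2; 3; 4; 5]%N by rewrite !inE; lia.
rewrite !inE => rE; apply/eqP; move: rE; do ?[case/orP]; move=> /eqP rE; rewrite rE.
- by apply: (@no_right 1 13 13) => //; lia.
- by apply: (@no_right 2 10 12) => //; lia.
- by apply: (@no_right 3 11 11) => //; lia.
- by apply: (@no_right 4 8 10) => //; lia.
- by apply: (@no_right 5 9 9) => //; lia.
Qed.

(** The coset of [u] consists of the words (v, vM + 1), parametrised by their left half. *)
Lemma shadow_split w : (w <= 14)%N ->
  #|[set x : 'rV['F_2]_92 | (hamming_weight x == w) && (u + x \in C)]| = (\sum_(l <- iota 0 w.+1) NL true l (w - l))%N.
Proof.
move=> w14; transitivity #|[set v : 'rV['F_2]_46 | (hamming_weight v + hamming_weight (v *m M + const_mx 1)%R == w)%N]|.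
  pose f (v : 'rV['F_2]_46) : 'rV['F_2]_92 := (row_mx v (v *m M + const_mx 1) : 'rV_(46 + 46)).
  have f_inj : injective f by move=> v v' e; have [] := @eq_row_mx _ 1 46 46 _ _ _ _ e.
  have fE v : u + f v = (row_mx v (v *m M) : 'rV_(46 + 46)).
    rewrite /u /f; transitivity (row_mx (0 + v) (const_mx 1 + (v *m M + const_mx 1)) : 'rV_(46 + 46)).
      by rewrite -(@add_row_mx _ 1 46 46).
    by rewrite add0r addrC -addrA F2_addvv addr0.
  rewrite -(card_imset _ f_inj); apply: eq_card => x; apply/idP/imsetP; rewrite !inE.
    move=> /andP[xw /systematic_codeP[v e]]; exists v; last first.
      by apply: (addrI u); rewrite fE e.
    have xE : x = f v by apply: (addrI u); rewrite fE e.
    by move: xw; rewrite xE inE (@hamming_weight_row_mx 46 46).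
  move=> [v]; rewrite inE => vw ->; rewrite (@hamming_weight_row_mx 46 46) vw fE.
  by apply/systematic_codeP; exists v.
rewrite -sum1dep_card big_mkcond.
under [RHS]eq_bigr => l _ do rewrite NL_E -sum1dep_card big_mkcond.
rewrite exchange_big; apply: eq_bigr => v _.
set p := hamming_weight v; set q := hamming_weight _.
case: eqP => [e|ne]; last first.
  by rewrite big_seq big1 // => l; rewrite mem_iota => lw; case: ifP => // /andP[/eqP h1 /eqP h2]; case: ne; lia.
have pin : p \in iota 0 w.+1 by rewrite mem_iota; lia.
rewrite (bigD1_seq p pin (iota_uniq _ _)).
rewrite eqxx /= (_ : q == (w - p)%N); last by apply/eqP; lia.
by rewrite big1 // => l lp; rewrite eq_sym (negbTE lp).
Qed.

(** The only v of weight 0 has the all-ones word, of weight 46, as its other half. *)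
Let NL0 r : (r < 46)%N -> NL true 0 r = 0%N.
Proof.
move=> r46; rewrite NL_E; apply/eqP; rewrite cards_eq0; apply/eqP/setP => v; rewrite !inE.
rewrite hamming_weight_eq0; case: eqP => //= ->; rewrite mul0mx add0r hamming_weight_ones.
by apply/negbTE; lia.
Qed.

Let NR0 r : (r < 46)%N -> NR true 0 r = 0%N.
Proof.
move=> r46; rewrite NR_E; apply/eqP; rewrite cards_eq0; apply/eqP/setP => v; rewrite !inE.
rewrite hamming_weight_eq0; case: eqP => //= ->; rewrite mul0mx add0r hamming_weight_ones.
by apply/negbTE; lia.
Qed.

Let L_E w : (w <= 14)%N -> shadow_count L w 0 = (\sum_(l <- iota 1 7) NL true l (w - l))%N.
Proof.
move=> w14; rewrite /L shadow_countE; last by rewrite /= !andbT; lia.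
by rewrite -[iota 1 7]/[seq x.1.1 | x <- left_bounds] big_map.
Qed.

Let R_E w : (w <= 14)%N -> shadow_count R w 8 =
  (\sum_(r <- iota 1 6) if 8 <= w - r then NL true (w - r) r else 0)%N.
Proof.
move=> w14; rewrite /R shadow_countE; last by rewrite /= !andbT; lia.
rewrite -[iota 1 6]/[seq x.1.1 | x <- right_bounds] big_map; apply: eq_bigr => x _.
by rewrite -transpose_pairs.
Qed.

(** A shadow word of weight at most 14 has left weight 1 to 7, counted by [L], or left weight at
    least 8 and right weight 1 to 6, counted by [R]; neither half can be zero. *)
Lemma shadow_weights j : (j < 15)%N -> ~~ odd j ->
  #|[set x : 'rV['F_2]_92 | (hamming_weight x == j) && (u + x \in C)]| =
  if j == 10%N then s10 else if j == 14%N then s14 else 0%N.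
Proof.
move=> j15 jodd; have jin : j \in [:: 0; 2; 4; 6; 8; 10; 12; 14]%N.
  by rewrite !inE; move: jodd; do 15 (case: j j15 => [|j] j15 //).
case: checkedE => _ _ _ /(_ j jin) <-.
have NLr0 l : (l < 46)%N -> NL true l 0 = 0%N by move=> l46; rewrite -transpose_pairs NR0.
rewrite shadow_split // L_E // R_E //.
have NL0r := NL0; move: NLr0 NL0r; move: (NL true) => N Nr0 N0 {jodd j15}.
(* When l exceeds the total weight, truncated subtraction makes [L] count words whose other half is
   zero; [Nr0] removes these terms. *)
by move: jin; rewrite !inE; do ?[case/orP]; move=> /eqP ->; rewrite !unlock; cbv -[addn];
  rewrite ?N0 ?Nr0 //; lia.
Qed.
End CheckedCode.

(* Natural numerals above 5000 are kept abstract and cannot be computed in unary. *)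
Fixpoint Z_of_uint (d : Decimal.uint) (z : Z) : Z :=
  match d with
  | Decimal.Nil => z
  | Decimal.D0 d => Z_of_uint d (10 * z)
  | Decimal.D1 d => Z_of_uint d (10 * z + 1)
  | Decimal.D2 d => Z_of_uint d (10 * z + 2)
  | Decimal.D3 d => Z_of_uint d (10 * z + 3)
  | Decimal.D4 d => Z_of_uint d (10 * z + 4)
  | Decimal.D5 d => Z_of_uint d (10 * z + 5)
  | Decimal.D6 d => Z_of_uint d (10 * z + 6)
  | Decimal.D7 d => Z_of_uint d (10 * z + 7)
  | Decimal.D8 d => Z_of_uint d (10 * z + 8)
  | Decimal.D9 d => Z_of_uint d (10 * z + 9)
  end%coqZ.

Lemma Z_of_uintP d n : Z.of_nat (Nat.of_uint_acc d n) = Z_of_uint d (Z.of_nat n).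
Proof.
by elim: d n => // d IH n; apply: etrans (IH _) (congr1 (Z_of_uint d) _);
  rewrite PeanoNat.Nat.tail_mul_spec; lia.
Qed.
Lemma of_nat_2425488 : Z.of_nat 2425488%N = 2425488%coqZ.
Proof. exact: Z_of_uintP. Qed.
Lemma of_nat_174800 : Z.of_nat 174800%N = 174800%coqZ.
Proof. exact: Z_of_uintP. Qed.

(** * Codes and weight enumerators from the checked data *)

Theorem checked_code_exists (abcd : seq bool * seq bool * (seq bool * seq bool)) (s10 s14 : nat) (alpha beta : int) :
  check_code abcd s10 s14 -> beta = - s10%:Z -> alpha = s14%:Z + 18 * s10%:Z ->
  exists C : binary_code 92,
    [/\ is_linear_code 46 16 C, self_dual C & take_poly 21 (weight_enumerator C) = W92_1 alpha beta].
Proof.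
case: abcd => -[a b] [c d] chk betaE alphaE.
have [unitary _] := andP chk.
have MU := quad_unitary unitary.
have W4 := quad_doubly_even unitary.
set M : 'M['F_2]_46 := quad_circulant a b c d in MU W4.
pose C := systematic_code M.
have C_sd : self_dual C := systematic_code_self_dual MU.
have wordP c0 : c0 \in C -> exists v : 'rV['F_2]_46, c0 = (row_mx v (v *m M) : 'rV_(46 + 46)) by move=> /systematic_codeP.
have C_min c0 : c0 \in C -> c0 != 0 -> (16 <= hamming_weight c0)%N.
  move=> /wordP[v ->] nz; rewrite (@hamming_weight_row_mx 46 46); apply: (code_weight chk).
  by apply: contra nz => /eqP ->; rewrite mul0mx; apply/eqP/rowP => i; rewrite mxE; case: split_ordP => j _; rewrite !mxE.
have C_shadow c0 : c0 \in C -> ~~ odd (hamming_weight c0) /\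
    sgn (inner_product c0 (row_mx 0 (const_mx 1) : 'rV_(46 + 46))) = (-1) ^+ (hamming_weight c0)./2.
  move=> /wordP[v ->]; rewrite (@hamming_weight_row_mx 46 46) (@inner_product_row_mx 46 46).
  have := W4 v; set l := hamming_weight v; set r := hamming_weight (v *m M) => lr.
  have -> : inner_product v 0 = 0 by rewrite /inner_product big1 // => i _; rewrite mxE mulr0.
  have -> : inner_product (v *m M) (const_mx 1) = (odd r)%:R.
    rewrite -natr_F2_odd /r hamming_weight_sum natr_sum; apply: eq_bigr => j _.
    by rewrite [const_mx _ _ _]mxE mulr1; case: (F2P ((v *m M) 0 j)) => ->.
  (* The weights of the halves agree modulo 4, so half their sum has the parity of [r]: the
     character of (0, 1) on C is the sign (-1)^(w/2). *)
  have half_odd : odd (l + r)./2 = odd r by lia.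
  split; first by lia.
  by rewrite add0r -signr_odd half_odd; case: (odd r).
have [A16 A18 A20] := enumerator_from_shadow C_sd (card_systematic_code M) C_shadow C_min (shadow_weights chk).
have wcE i (z : Z) : (weight_count C i)%:R = z -> Z.of_nat (weight_count C i) = z by move=> <-; lia.
move: A16 A18 A20 => /wcE A16 /wcE A18 /wcE A20.
have zero_coef i : [|| odd i, 0 < i < 16 | 76 < i < 92]%N -> weight_count C i = 0%N.
  by move=> iz; have := A_zero C_sd (card_systematic_code M) C_shadow C_min iz; lia.
have coef0 : weight_count C 0 = 1%N by have := A0 C_min; lia.
exists C; split=> //.
  split; first exact: dim_systematic_code.
  have distE (x y : 'rV['F_2]_92) : hamming_distance x y = hamming_weight (x - y).
    rewrite /hamming_distance /hamming_weight; apply: eq_card => i; rewrite !inE !mxE.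
    by rewrite subr_eq0.
  split=> [x y xC yC xy|].
    by rewrite distE C_min ?rpredB // subr_eq0.
  (* The number of words of weight 16 is 4692 + 72 [s10] + 4 [s14], which is positive, so the bound
     16 is attained. *)
  have : (0 < weight_count C 16)%N by lia.
  case/card_gt0P => x; rewrite inE => /andP[xC /eqP x16].
  exists x, 0; rewrite distE subr0 mem0v; split=> //.
  by apply: contraTneq isT => x0; move: x16; rewrite x0 hamming_weight0.
have k16 : 4692 + 4 * alpha = (weight_count C 16)%:Z by lia.
have k18 : 174800%N%:R - 8 * alpha + 256 * beta = (weight_count C 18)%:Z.
  by have := of_nat_174800; lia.
have k20 : 2425488%N%:R - 52 * alpha - 2048 * beta = (weight_count C 20)%:Z.
  by have := of_nat_2425488; lia.
have -> : W92_1 alpha beta = 1 + (weight_count C 16)%:Z *: 'X^16 + (weight_count C 18)%:Z *: 'X^18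
    + (weight_count C 20)%:Z *: 'X^20.
  exact: (f_equal3 (fun x y z : int => 1 + x *: 'X^16 + y *: 'X^18 + z *: 'X^20) k16 k18 k20).
move=> {k16 k18 k20}.
apply/polyP => i; rewrite coef_take_poly /weight_enumerator.
rewrite !coefD coef1 !coefZ !coefXn.
have [i21|i21] := ltnP i 21; last first.
  by rewrite !gtn_eqF ?mulr0 ?addr0 //; apply: leq_trans i21.
have -> : (\sum_(j < 93) (weight_count C j)%:Z *: 'X^j)`_i = (weight_count C i)%:Z.
  rewrite coef_sum (bigD1 (Ordinal (leq_trans i21 (isT : 21 <= 93)%N))) //= big1 ?addr0.
    by rewrite coefZ coefXn eqxx mulr1.
  move=> j; rewrite -val_eqE /= => ji; rewrite coefZ coefXn eq_sym (negbTE ji) mulr0 //.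
(* Up to degree 20 these are the only exponents not excluded by evenness and the minimum weight. *)
have : (i \in [:: 0; 16; 18; 20] \/ [|| odd i, 0 < i < 16 | 76 < i < 92])%N.
  rewrite !inE; case: (boolP (odd i)) => /= oi; [by right | lia].
case=> [|iz]; last first.
  rewrite zero_coef //; have iE : i \notin [:: 0; 16; 18; 20]%N by rewrite !inE; lia.
  by move: iE; rewrite !inE => /norP[/negbTE -> /norP[/negbTE -> /norP[/negbTE -> /negbTE ->]]]; rewrite !mulr0 !addr0.
rewrite !inE => /or4P[] /eqP ->; rewrite /= ?mulr0 ?mulr1 ?add0r ?addr0; rewrite ?coef0 //.
Qed.

(* (number of shadow vectors of weight 10, of weight 14, first rows of the four circulants
   as binary numbers) *)
Definition codes : seq (nat * nat * (seq bool * seq bool * (seq bool * seq bool))) :=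
  [:: (69, 552, code_data 4203303 7264451 7264451 2441545);
      (46, 575, code_data 3308714 8360834 8360834 5528277);
      (46, 759, code_data 826028 3341917 3341917 8387694);
      (46, 989, code_data 3473276 1136817 1136817 6550751);
      (46, 1058, code_data 2312029 8017573 8017573 2862636);
      (46, 1127, code_data 1306514 1532615 3172104 8326705);
      (23, 690, code_data 4791219 7064839 7064839 7866219);
      (23, 897, code_data 1405903 230673 230673 6631762);
      (23, 1127, code_data 2975557 6717666 6717666 912473);
      (23, 1334, code_data 5217274 1352881 1352881 7296038);
      (0, 713, code_data 8169530 6085120 6085120 3155525);
      (0, 1311, code_data 7065425 2174924 2174924 2511019)].

(** The whole enumeration of small words, for all twelve codes, is carried out by this
    evaluation. *)
Lemma codes_checked : all (fun x => check_code x.2 x.1.1 x.1.2) codes.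
Proof. by vm_compute. Qed.

Theorem mainTheorem6 (alpha beta : int)
  (params :
    [\/ beta = -69 /\ alpha = 23 * 78,
        beta = -46 /\ alpha \in [seq 23 * z | z <- [:: 61; 69; 79; 82; 85]],
        beta = -23 /\ alpha \in [seq 23 * z | z <- [:: 48; 57; 67; 76]]
      | beta = 0 /\ alpha \in [seq 23 * z | z <- [:: 31; 57]]]) :
  exists C : binary_code 92,
    [/\ is_linear_code 46 16 C,
        self_dual C
      & take_poly 21 (weight_enumerator C) = W92_1 alpha beta].
Proof.
(* Each admissible pair determines [s10] = -[beta] and [s14] = [alpha] + 18 [beta], and the table
   has a row for each of the twelve pairs. *)
suff /hasP[x /(allP codes_checked) chk /andP[/eqP betaE /eqP alphaE]] :
    has (fun x => (beta == - x.1.1%:Z) && (alpha == x.1.2%:Z + 18 * x.1.1%:Z)) codes.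
  exact: checked_code_exists chk betaE alphaE.
case: params => -[-> /=]; rewrite ?inE; first by move=> ->; vm_compute.
all: by do ?[case/orP]; move=> /eqP ->; vm_compute.
Qed.
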